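(* Let $L,g\in C^1([a,b]\times\mathbb{R}^2;\mathbb{R})$, let $\phi:[a,b]\times\mathbb{R}\to\mathbb{R}$ be of class $C^1$, let $\psi:[a,b]\to\mathbb{R}$ be differentiable, and let $x_a\in\mathbb{R}$ be fixed. Suppose that $(x,T)\in D$ gives a local minimum for the functional $$\mathcal{J}(x,T)=\int_a^T L[x]_\gamma^{\alpha,\beta}(t)\,dt+\phi(T,x(T))$$ on $D$ subject to the boundary condition $x(a)=x_a$ and the isoperimetric constraint $$\int_a^T g[x]_\gamma^{\alpha,\beta}(t)\,dt=\psi(T)$$ (the terminal time $T$ and the terminal state $x(T)$ being free). Then there exists $(\lambda_0,\lambda)\in\mathbb{R}^2$, $(\lambda_0,\lambda)\neq(0,0)$, such that, with $F:[a,b]\times\mathbb{R}^2\to\mathbb{R}$ defined by $F=\lambda_0L-\lambda g$, $(x,T)$ satisfies the fractional Euler--Lagrange equations $$\partial_2 F[x]_\gamma^{\alpha,\beta}(t)+D_{\overline{\gamma},T}^{\beta(\cdot,\cdot),\alpha(\cdot,\cdot)}\partial_3 F[x]_\gamma^{\alpha,\beta}(t)=0$$ on the interval $[a,T]$, and $$\gamma_2\left({}_aD_t^{\beta(\cdot,\cdot)}\partial_3 F[x]_\gamma^{\alpha,\beta}(t)-{}_TD_t^{\beta(\cdot,\cdot)}\partial_3 F[x]_\gamma^{\alpha,\beta}(t)\right)=0$$ on the interval $[T,b]$.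
   Context: Let $a<b$ be reals. The fractional orders $\alpha,\beta:[a,b]^2\to(0,1)$ are continuous, and $\gamma=(\gamma_1,\gamma_2)\in[0,1]^2$ is a constant vector. Fractional operators. For an order $\alpha$ (and likewise for $\beta$), and base points $p,q\in[a,b]$ (here $p\in\{a,T\}$, $q\in\{T,b\}$), the left and right Riemann--Liouville derivatives are $${}_pD_t^{\alpha(\cdot,\cdot)}y(t)=\frac{d}{dt}\int_p^t\frac{(t-\tau)^{-\alpha(t,\tau)}}{\Gamma(1-\alpha(t,\tau))}y(\tau)\,d\tau,\qquad {}_tD_q^{\alpha(\cdot,\cdot)}y(t)=\frac{d}{dt}\int_t^q\frac{-(\tau-t)^{-\alpha(\tau,t)}}{\Gamma(1-\alpha(\tau,t))}y(\tau)\,d\tau;$$ the left and right Caputo derivatives are $${}^C_aD_t^{\alpha(\cdot,\cdot)}x(t)=\int_a^t\frac{(t-\tau)^{-\alpha(t,\tau)}}{\Gamma(1-\alpha(t,\tau))}x'(\tau)\,d\tau,\qquad {}^C_tD_b^{\alpha(\cdot,\cdot)}x(t)=\int_t^b\frac{-(\tau-t)^{-\alpha(\tau,t)}}{\Gamma(1-\alpha(\tau,t))}x'(\tau)\,d\tau.$$ The combined Caputo derivative is ${}^CD_\gamma^{\alpha(\cdot,\cdot),\beta(\cdot,\cdot)}x(t)=\gamma_1\,{}^C_aD_t^{\alpha(\cdot,\cdot)}x(t)+\gamma_2\,{}^C_tD_b^{\beta(\cdot,\cdot)}x(t)$. The dual derivative is $D_{\overline{\gamma},c}^{\beta(\cdot,\cdot),\alpha(\cdot,\cdot)}=\gamma_2\,{}_aD_t^{\beta(\cdot,\cdot)}+\gamma_1\,{}_tD_c^{\alpha(\cdot,\cdot)}$,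 where $\overline{\gamma}=(\gamma_2,\gamma_1)$ and $c\in(a,b]$. Notation: $[x]_\gamma^{\alpha,\beta}(t)=(t,x(t),{}^CD_\gamma^{\alpha(\cdot,\cdot),\beta(\cdot,\cdot)}x(t))$; for a function $z$ of several real variables, $z[x]_\gamma^{\alpha,\beta}(t)$ means $z([x]_\gamma^{\alpha,\beta}(t))$, and $\partial_i z$ is the partial derivative with respect to the $i$th argument. In expressions such as $D\,\partial_3 F[x]_\gamma^{\alpha,\beta}(t)$ the operator $D$ is applied to the function $t\mapsto\partial_3 F([x]_\gamma^{\alpha,\beta}(t))$. The set $D=\{(x,t)\in C^1([a,b])\times[a,b]: {}^CD_\gamma^{\alpha(\cdot,\cdot),\beta(\cdot,\cdot)}x(t)\text{ exists and is continuous on }[a,b]\}$ is endowed with the norm $\|(x,t)\|=\max_{a\le t\le b}|x(t)|+\max_{a\le t\le b}|{}^CD_\gamma^{\alpha(\cdot,\cdot),\beta(\cdot,\cdot)}x(t)|+|t|$. A local minimum of $\mathcal{J}$ subject to constraints is an element $(x,T)\in D$ satisfying the constraints such that, for some $\delta>0$, $\mathcal{J}(x,T)\le\mathcal{J}(\tilde x,\tilde T)$ for every $(\tilde x,\tilde T)\in D$ satisfying the constraints with $\|(\tilde x-x,\tilde T-T)\|<\delta$.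
   Formalization: The separate Riemann–Liouville derivatives need not exist (e.g. at t=a), so d/dt is taken of the whole combination of fractional integrals, whose differentiability is proved; the equations hold termwise wherever both derivatives exist. One-point intervals (T=a or T=b) carry no claim. *)

(* Defs.v *)
From mathcomp Require Import all_boot all_order all_algebra.
From mathcomp Require Import all_classical all_reals all_analysis.

Set Implicit Arguments.
Unset Strict Implicit.
Unset Printing Implicit Defensive.

Import Order.TTheory GRing.Theory Num.Theory.
Import numFieldNormedType.Exports.

Local Open Scope classical_set_scope.
Local Open Scope ring_scope.

(* Functions on [a, b] are represented by functions on R of which only the
   values on [a, b] matter; all integrals are Lebesgue integrals. *)

(** Derivatives relative to a set *)

(* One-sided derivatives at the endpoints of an interval A. If t is an isolated
   point of A (i.e., A = [t, t]) the filter is improper and the property holds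
   for every l. *)
Definition is_derivative_within (R : realType) (A : set R) (f : R -> R)
    (t l : R) : Prop :=
  (fun s => (f s - f t) / (s - t)) @ within A t^' --> l.

Definition differentiable_on (R : realType) (a b : R) (f : R -> R) : Prop :=
  forall t, t \in `[a, b] -> exists l, is_derivative_within `[a, b] f t l.

Definition C1_on (R : realType) (a b : R) (x : R -> R) : Prop :=
  exists dx : R -> R,
    (forall t, t \in `[a, b] -> is_derivative_within `[a, b] x t (dx t)) /\
    {within `[a, b], continuous dx}.

Definition partial2 (R : realType) (z : R -> R -> R -> R) (t y v : R) : R :=
  derive1 (fun y' => z t y' v) y.

Definition partial3 (R : realType) (z : R -> R -> R -> R) (t y v : R) : R :=
  derive1 (fun v' => z t y v') v.

(* z is of class C^1 on [a, b] x R. *)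
Definition C1_strip2 (R : realType) (a b : R) (z : R -> R -> R) : Prop :=
  let S := [set p : R * R | p.1 \in `[a, b]] in
  exists z1 : R -> R -> R,
    [/\ forall t y, t \in `[a, b] ->
          is_derivative_within `[a, b] (z ^~ y) t (z1 t y) /\
          derivable (z t) y 1,
        {within S, continuous (fun p : R * R => z p.1 p.2)},
        {within S, continuous (fun p : R * R => z1 p.1 p.2)} &
        {within S, continuous (fun p : R * R => derive1 (z p.1) p.2)}].

(* z is of class C^1 on [a, b] x R^2. *)
Definition C1_strip3 (R : realType) (a b : R) (z : R -> R -> R -> R) : Prop :=
  let S := [set p : R * R * R | p.1.1 \in `[a, b]] in
  exists z1 : R -> R -> R -> R,
    (forall t y v, t \in `[a, b] ->
      [/\ is_derivative_within `[a, b] (fun s => z s y v) t (z1 t y v),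
          derivable (fun y' => z t y' v) y 1 &
          derivable (fun v' => z t y v') v 1]) /\
    [/\ {within S, continuous (fun p : R * R * R => z p.1.1 p.1.2 p.2)},
        {within S, continuous (fun p : R * R * R => z1 p.1.1 p.1.2 p.2)},
        {within S, continuous
          (fun p : R * R * R => partial2 z p.1.1 p.1.2 p.2)} &
        {within S, continuous
          (fun p : R * R * R => partial3 z p.1.1 p.1.2 p.2)}].

(** Variable-order fractional operators *)

Definition fractional_order (R : realType) (a b : R) (al : R -> R -> R) : Prop :=
  {within `[a, b] `*` `[a, b], continuous (fun p : R * R => al p.1 p.2)} /\
  forall t tau, t \in `[a, b] -> tau \in `[a, b] -> 0 < al t tau < 1.

Definition Gamma (R : realType) (s : R) : R :=
  \int[lebesgue_measure]_(u in `]0, +oo[) (u `^ (s - 1) * expR (- u)).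

Definition left_kernel (R : realType) (al : R -> R -> R) (t tau : R) : R :=
  (t - tau) `^ (- al t tau) / Gamma (1 - al t tau).

(* The sign and the swapped arguments of al are part of the right operators. *)
Definition right_kernel (R : realType) (al : R -> R -> R) (t tau : R) : R :=
  - (tau - t) `^ (- al tau t) / Gamma (1 - al tau t).

Definition left_integral (R : realType) (al : R -> R -> R) (p : R)
    (y : R -> R) (t : R) : R :=
  \int[lebesgue_measure]_(tau in `[p, t]) (left_kernel al t tau * y tau).

Definition right_integral (R : realType) (al : R -> R -> R) (q : R)
    (y : R -> R) (t : R) : R :=
  \int[lebesgue_measure]_(tau in `[t, q]) (right_kernel al t tau * y tau).

(* l is the value at t of the left Riemann-Liouville derivative of y with base
   point p, as an operator on [p, b]. *)
Definition is_left_RL (R : realType) (al : R -> R -> R) (p b : R)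
    (y : R -> R) (t l : R) : Prop :=
  is_derivative_within `[p, b] (left_integral al p y) t l.

(* l is the value at t of the right Riemann-Liouville derivative of y with base
   point q, as an operator on [a, q]. *)
Definition is_right_RL (R : realType) (al : R -> R -> R) (a q : R)
    (y : R -> R) (t l : R) : Prop :=
  is_derivative_within `[a, q] (right_integral al q y) t l.

(* l is the value at t, in [a, c], of the dual derivative
   gam.2 * aD_t^be + gam.1 * tD_c^al applied to y, the derivative d/dt being
   taken of the linear combination as a whole. Where both Riemann-Liouville
   derivatives exist this is the combination of their values; but for orders
   that are merely continuous, and at the endpoints a and c, the combination may
   be differentiable although its two terms are not. *)
Definition is_dual_derivative (R : realType) (gam : R * R)
    (be al : R -> R -> R) (a c : R) (y : R -> R) (t l : R) : Prop :=
  is_derivative_within `[a, c]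
    (fun s => gam.2 * left_integral be a y s + gam.1 * right_integral al c y s)
    t l.

(* The same convention for gam.2 * (aD_t^be - TD_t^be) on [T, b]. *)
Definition is_left_RL_difference (R : realType) (gam : R * R)
    (be : R -> R -> R) (a T b : R) (y : R -> R) (t l : R) : Prop :=
  is_derivative_within `[T, b]
    (fun s => gam.2 * (left_integral be a y s - left_integral be T y s)) t l.

(* For x of class C^1 on [a, b], derive1 x is its derivative on ]a, b[; the two
   endpoints are negligible. *)
Definition left_Caputo (R : realType) (al : R -> R -> R) (a : R)
    (x : R -> R) (t : R) : R :=
  left_integral al a (derive1 x) t.

Definition right_Caputo (R : realType) (al : R -> R -> R) (b : R)
    (x : R -> R) (t : R) : R :=
  right_integral al b (derive1 x) t.

Definition combined_Caputo (R : realType) (a b : R) (gam : R * R)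
    (al be : R -> R -> R) (x : R -> R) (t : R) : R :=
  gam.1 * left_Caputo al a x t + gam.2 * right_Caputo be b x t.

Definition combined_Caputo_exists (R : realType) (a b : R)
    (al be : R -> R -> R) (x : R -> R) (t : R) : Prop :=
  lebesgue_measure.-integrable `[a, t]
    (EFin \o (fun tau => left_kernel al t tau * derive1 x tau)) /\
  lebesgue_measure.-integrable `[t, b]
    (EFin \o (fun tau => right_kernel be t tau * derive1 x tau)).

(* along z x is the function z[x] : t |-> z(t, x(t), combined Caputo of x). *)
Definition along (R : realType) (a b : R) (gam : R * R) (al be : R -> R -> R)
    (z : R -> R -> R -> R) (x : R -> R) (t : R) : R :=
  z t (x t) (combined_Caputo a b gam al be x t).

(** The variational problem *)

Definition in_D (R : realType) (a b : R) (gam : R * R) (al be : R -> R -> R)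
    (x : R -> R) (T : R) : Prop :=
  [/\ C1_on a b x, T \in `[a, b],
      forall t, t \in `[a, b] -> combined_Caputo_exists a b al be x t &
      {within `[a, b], continuous (combined_Caputo a b gam al be x)}].

(* On D the suprema are maxima of continuous functions over [a, b]. *)
Definition normD (R : realType) (a b : R) (gam : R * R) (al be : R -> R -> R)
    (x : R -> R) (T : R) : R :=
  sup [set `|x t| | t in `[a, b]] +
  sup [set `|combined_Caputo a b gam al be x t| | t in `[a, b]] +
  `|T|.

Definition local_minimum (R : realType) (a b : R) (gam : R * R)
    (al be : R -> R -> R) (J : (R -> R) -> R -> R)
    (constraints : (R -> R) -> R -> Prop) (x : R -> R) (T : R) : Prop :=
  [/\ in_D a b gam al be x T, constraints x T &
      exists2 delta : R, 0 < delta &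
        forall (x' : R -> R) (T' : R),
          in_D a b gam al be x' T' -> constraints x' T' ->
          normD a b gam al be (fun t => x' t - x t) (T' - T) < delta ->
          J x T <= J x' T'].

(* Main.v *)
Require Import Defs.
From mathcomp Require Import all_boot all_order all_algebra.
From mathcomp Require Import all_classical all_reals all_analysis.
From mathcomp Require Import measurable_realfun ring lra.
Import Order.TTheory GRing.Theory Num.Theory.
Import numFieldNormedType.Exports.
Local Open Scope classical_set_scope.
Local Open Scope ring_scope.

(** The terminal time [T] is kept fixed and the state is varied along primitives [h]
    of continuous functions [w] with [h a = h T = 0]; then neither [phi] nor [psi]
    moves, and the combined Caputo derivative of [h] at [t] is [\int_a^b M t s * w s ds]
    for a kernel [M] with [|M t s| <= C * |t - s| ^ -A], [A < 1]. If the first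
    variation of the constraint does not vanish identically, the intermediate value
    theorem corrects any descent direction into one respecting the constraint, which
    produces the multipliers. By Fubini's theorem the first variation of [F] is
    [\int_a^b w * P], where [P s = \int_s^T d2F + \int_a^T M t s * d3F t dt], so the
    lemma of du Bois-Reymond makes [P] constant on [[a, T]] and zero on [[T, b]]. The
    second term of [P] is, up to sign, the combination of fractional integrals whose
    derivative is the dual derivative on [[a, T]], and the difference of the two left
    ones on [[T, b]]. As [P] is continuous up to the endpoints, differentiating
    gives the existence of these derivatives as well as the equations. *)

(** The orders are merely continuous, so the Riemann-Liouville derivatives of [d3F] need not exist
    separately, and fractional integration by parts in differentiated form is out of reach. Hence
    the state and its Caputo derivative are both expressed through [w = h'] by kernels integrable
    across the diagonal, and exchanging integrals replaces integrating by parts. A derivative of a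
    fractional integral appears only at the very end, and only for the whole combination. The
    exponent [A < 1] comes from compactness: on the square a continuous order with values below 1
    stays away from 1.

    The condition [h T = 0] restricts [w] on [[a, T]] only, which is why [P] is merely constant
    there but zero on [[T, b]]. The values of [w] beyond [T] matter because the right Caputo
    derivative at a time before [T] integrates [h'] up to [b].

    If the first variation of the constraint vanishes on all admissible directions, the multipliers
    are [(0, 1)]; otherwise [lam0 = 1]. *)

Set Implicit Arguments.
Unset Strict Implicit.
Unset Printing Implicit Defensive.

(** * Continuity, compactness and integrals over segments *)

Section Continuous.
Context {R : realType}.
Notation mu := (@lebesgue_measure R).
Implicit Types (a b c d t M : R) (f g : R -> R).

(* Composition with [clamp a b] turns a function continuous on [[a, b]] into one
   continuous on the whole line, so that continuity relative to a set is needed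
   only to read the hypotheses and to state the conclusions. *)
Definition clamp a b t : R := Num.max a (Num.min b t).

Lemma clamp_id a b t : t \in `[a, b] -> clamp a b t = t.
Proof.
by rewrite in_itv/= => /andP[at_ tb]; rewrite /clamp (min_idPr tb) (max_idPr at_).
Qed.

Lemma clamp_in a b t : a <= b -> clamp a b t \in `[a, b].
Proof. by move=> ab; rewrite in_itv/= /clamp le_max lexx ge_max ab ge_min lexx. Qed.

Lemma continuous_maxl (T : topologicalType) (u : T -> R) c :
  continuous u -> continuous (fun x => Num.max c (u x)).
Proof.
move=> cu x.
by apply: (@continuous_max R T (cst c) u); [exact: cvg_cst|exact: cu].
Qed.

Lemma continuous_minl (T : topologicalType) (u : T -> R) c :
  continuous u -> continuous (fun x => Num.min c (u x)).
Proof.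
move=> cu x.
by apply: (@continuous_min R T (cst c) u); [exact: cvg_cst|exact: cu].
Qed.

Lemma continuous_clamp a b : continuous (clamp a b).
Proof. by apply: continuous_maxl; apply: continuous_minl => x; exact: cvg_id. Qed.

Lemma within_continuous_comp (S U : topologicalType) (A : set U) (f : U -> R)
    (r : S -> U) : {within A, continuous f} -> continuous r ->
  (forall x, A (r x)) -> continuous (f \o r).
Proof.
move=> /subspace_continuousP cf cr Ar x; apply/cvgrPdist_lt => e e0.
have /cvgrPdist_lt /(_ e e0) H := cf _ (Ar x).
have : \forall s \near x, (fun q => A q -> `|f (r x) - f q| < e) (r s).
  exact: (cr x _ H).
by apply: filterS => s; apply.
Qed.

Lemma within_continuous_clamp a b f : a <= b ->
  {within `[a, b], continuous f} -> continuous (f \o clamp a b).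
Proof.
move=> ab cf; apply: (within_continuous_comp cf); first exact: continuous_clamp.
by move=> t; exact: clamp_in.
Qed.

Lemma continuous_integrable_itv f c d : continuous f ->
  mu.-integrable `[c, d] (EFin \o f).
Proof.
move=> cf; apply: continuous_compact_integrable; first exact: segment_compact.
exact: continuous_subspaceT.
Qed.

Lemma ler_norm_Rintegral_itv f c d M : c <= d ->
  mu.-integrable `[c, d] (EFin \o f) ->
  (forall t, t \in `[c, d] -> `|f t| <= M) ->
  `|\int[mu]_(t in `[c, d]) f t| <= M * (d - c).
Proof.
move=> cd intf fM.
have /le_trans -> // := @le_normr_Rintegral _ _ _ mu `[c, d]%classic _ (measurable_itv _) intf.
have -> : M * (d - c) = \int[mu]_(t in `[c, d]) M.
  rewrite Rintegral_cst//= lebesgue_measure_itv/= lte_fin.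
  by case: ltP => //= dc; rewrite (_ : d = c) ?subrr//; apply/eqP; rewrite eq_le dc.
apply: le_Rintegral => //.
- by have /= := integrable_norm intf; apply.
- by apply: continuous_integrable_itv => t; exact: cvg_cst.
Qed.

Lemma Rintegral_itv_cat f a b s : mu.-integrable `[a, b] (EFin \o f) ->
  a <= s -> s <= b ->
  \int[mu]_(x in `[a, b]) f x =
  \int[mu]_(x in `[a, s]) f x + \int[mu]_(x in `[s, b]) f x.
Proof.
move=> intf as_ sb.
rewrite -(@Rintegral_itv_obnd_cbnd _ s); last first.
  have := intf; apply: integrableS => //.
  by apply: subset_itvr; rewrite bnd_simp.
by rewrite -(Rintegral_itvB intf) ?bnd_simp// addrC subrK.
Qed.

Lemma continuous_comp_pair (S T U V : topologicalType) (f : T * U -> V)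
    (u : S -> T) (v : S -> U) : continuous f -> continuous u -> continuous v ->
  continuous (fun x => f (u x, v x)).
Proof.
move=> cf cu cv x; apply: (@continuous_comp _ _ _ (fun x => (u x, v x)) f).
  exact: (cvg_pair (cu x) (cv x)).
exact: cf.
Qed.

(** By the near-covering form of compactness it suffices to find, for each [u] in [K],
    neighbourhoods of [u] and [t] on which the estimate holds; there both values are compared with
    [f (t, u)]. *)
Lemma compact_continuous_near (T U : topologicalType) (K : set U)
    (f : T * U -> R) (t : T) (e : R) : compact K -> continuous f -> 0 < e ->
  \forall s \near t, forall u, K u -> `|f (s, u) - f (t, u)| < e.
Proof.
move=> /compact_near_coveringP cK cf e0.
apply: (cK _ _ (fun s u => `|f (s, u) - f (t, u)| < e)) => u Ku.
have e20 : 0 < e / 2 by rewrite divr_gt0.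
have /cvgrPdist_lt /(_ _ e20)[/= [A B] /= [At Bu] AB] := cf (t, u).
exists (B, A) => //= -[v s] /= [Bv As].
have /= H1 := AB (s, v) (conj As Bv).
have /= H2 := AB (t, v) (conj (nbhs_singleton At) Bv).
rewrite (_ : _ - _ = - (f (t, u) - f (s, v)) + (f (t, u) - f (t, v))); last by ring.
by rewrite (le_lt_trans (ler_normD _ _))// normrN (splitr e) ltrD.
Qed.

Lemma continuous_Rintegral_param (T : topologicalType) (K : T -> R -> R) c d :
  continuous (fun p : T * R => K p.1 p.2) ->
  continuous (fun x => \int[mu]_(s in `[c, d]) K x s).
Proof.
move=> cK t.
have cKt (s : T) : continuous (K s).
  apply: (continuous_comp_pair (u := cst s) (v := id) cK) => x.
  - exact: cvg_cst.
  - exact: cvg_id.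
have [dc|cd] := ltP d c.
  rewrite set_itv_ge ?bnd_simp -?ltNge//.
  rewrite (_ : (fun x : T => _) = cst 0); first exact: cvg_cst.
  by apply/funext => s; rewrite Rintegral_set0.
apply/cvgrPdist_lt => e e0.
have e'0 : 0 < e / (d - c + 1).
  by rewrite divr_gt0// ltr_wpDl// subr_ge0.
have := compact_continuous_near t (@segment_compact _ c d) cK e'0.
apply: filterS => s /= H.
rewrite -RintegralB//; [|exact: continuous_integrable_itv..].
apply: (@le_lt_trans _ _ (e / (d - c + 1) * (d - c))).
  apply: ler_norm_Rintegral_itv => //.
    apply: continuous_integrable_itv => u; apply: cvgB; exact: cKt.
  by move=> u ucd; rewrite distrC ltW// H.
rewrite mulrAC ltr_pdivrMr ?ltr_wpDl ?subr_ge0//.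
by rewrite ltr_pM2l// ltrDl.
Qed.

(** The primitive of [f] from [a] lies between 0 and the full integral, so it is constant, and its
    derivative [f] vanishes. *)
Lemma Rintegral_continuous_eq0 f a b : continuous f ->
  (forall t, t \in `[a, b] -> 0 <= f t) ->
  \int[mu]_(t in `[a, b]) f t = 0 -> a < b -> forall t, t \in `]a, b[ -> f t = 0.
Proof.
move=> cf f0 If ab t; rewrite in_itv/= => /andP[at_ tb].
have If0 c d : a <= c -> d <= b -> 0 <= \int[mu]_(t in `[c, d]) f t.
  move=> ac db; apply: Rintegral_ge0 => x /=; rewrite in_itv/= => /andP[cx xd].
  by apply: f0; rewrite in_itv/= (le_trans ac)//= (le_trans xd).
have IF s : s \in `]a, b[ -> \int[mu]_(x in `[a, s]) f x = 0.
  rewrite in_itv/= => /andP[as_ sb].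
  apply/eqP; rewrite eq_le If0 ?andbT// ?(ltW sb)//.
  rewrite -If (Rintegral_itv_cat (continuous_integrable_itv a b cf) (ltW as_) (ltW sb)).
  by rewrite lerDl; apply: If0 => //; exact: ltW.
have [_ /= <-] := continuous_FTC1_closed (f := f) tb
  (continuous_integrable_itv a b cf) at_ (cf t).
rewrite -[RHS](@derive1_cst R R 0 t) !derive1E.
apply: near_eq_derive => //; near=> s.
by rewrite /= IF//; near: s; apply: near_in_itvoo; rewrite in_itv/= at_.
Unshelve. all: by end_near. Qed.

End Continuous.

(** * Improper integrals of powers of the distance *)

Section SingularIntegrals.
Context {R : realType}.
Notation mu := (@lebesgue_measure R).
Implicit Types (a b c d s t A C M : R) (f F : R -> R).

(** Since [f] may blow up at [c] and [d], the fundamental theorem is applied on segments exhausting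
    the open interval, where it gives a difference of two values of [F]; monotone convergence does
    the rest. *)
Lemma ge0_integral_oo_le f F c d M : 0 <= M ->
  {in `]c, d[, continuous f} -> {in `]c, d[, forall t, 0 <= f t} ->
  {in `]c, d[, forall t, is_derive t 1 F (f t)} ->
  {in `]c, d[, forall t, `|F t| <= M} ->
  (\int[mu]_(t in `]c, d[) (f t)%:E <= (2 * M)%:E)%E.
Proof.
move=> M0 cf f0 dF FM.
have [dc|cd] := leP d c.
  by rewrite set_itv_ge ?bnd_simp -?leNgt// integral_set0 lee_fin mulr_ge0.
(* Starting at denominator 3 keeps every segment [[c + e n, d - e n]] nondegenerate. *)
pose e (n : nat) : R := (d - c) / n.+3%:R.
have e0 n : 0 < e n by rewrite divr_gt0// subr_gt0.
have ele m n : (m <= n)%N -> e n <= e m.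
  move=> mn; rewrite ler_wpM2l ?subr_ge0 ?(ltW cd)// lef_pV2 ?posrE//.
  by rewrite ler_nat.
have e3 n : e n <= (d - c) / 3 by exact: (ele 0 n).
pose I n := `[c + e n, d - e n]%classic.
have IU : `]c, d[%classic = \bigcup_n I n.
  apply/seteqP; split=> t /=; rewrite in_itv/=.
    move=> /andP[ct td].
    have mpos : 0 < Num.min (t - c) (d - t) by rewrite lt_min !subr_gt0 ct.
    have dc0 : 0 <= d - c by rewrite subr_ge0 ltW.
    have [n nP] : exists n : nat, (d - c) / Num.min (t - c) (d - t) < n%:R.
      by eexists; exact: archi_boundP (divr_ge0 dc0 (ltW mpos)).
    exists n => //; rewrite /I/= in_itv/=.
    suff : e n < Num.min (t - c) (d - t).
      by rewrite lt_min => /andP[]; lra.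
    rewrite /e ltr_pdivrMr// mulrC -ltr_pdivrMr// (lt_le_trans nP)// ler_nat.
    by rewrite -addn3 leq_addr.
  move=> [n _]; rewrite /I/= in_itv/= => /andP[].
  by have := e0 n; lra.
have Ioo n t : I n t -> t \in `]c, d[.
  move=> Int; have : (\bigcup_n I n) t by exists n.
  by rewrite -IU.
have mf : measurable_fun `]c, d[ f.
  by apply: open_continuous_measurable_fun => // t; rewrite inE; exact: cf.
rewrite IU.
have cvgI : (\int[mu]_(t in I n) (f t)%:E)%E @[n --> \oo] -->
    (\int[mu]_(t in \bigcup_n I n) (f t)%:E)%E.
  apply: ge0_nondecreasing_set_cvg_integral.
  - move=> m n mn; apply/subsetPset; apply: subset_itv; rewrite bnd_simp;
    by have := ele _ _ mn; lra.
  - by move=> n; exact: measurable_itv.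
  - by move=> n; apply/measurable_EFinP; apply: measurable_funS mf => // t /Ioo.
  - by move=> n t /Ioo /f0; rewrite lee_fin.
rewrite -(cvg_lim _ cvgI)//.
apply: lime_le; last first.
  near=> n; rewrite (@continuous_FTC2 _ f F)//.
  + rewrite -EFinB lee_fin.
    have /FM : c + e n \in `]c, d[.
      by rewrite in_itv/=; have := e3 n; have := e0 n; lra.
    have /FM : d - e n \in `]c, d[.
      by rewrite in_itv/=; have := e3 n; have := e0 n; lra.
    by rewrite !ler_norml; lra.
  + by have := e3 n; have := e0 n; lra.
  + apply: continuous_in_subspaceT => t; rewrite inE => /Ioo; exact: cf.
  + have dFI t : I n t -> derivable F t 1 by move=> /Ioo /dF [].
    have cFI t : I n t -> {for t, continuous F}.
      by move=> /dFI; rewrite derivable1_diffP; exact: differentiable_continuous.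
    split.
    * by move=> t tI; apply: dFI; exact: (subset_itv_oo_cc tI).
    * apply: cvg_at_right_filter; apply: cFI; rewrite /I/= in_itv/= lexx/=.
      by have := e3 n; have := e0 n; lra.
    * apply: cvg_at_left_filter; apply: cFI; rewrite /I/= in_itv/= lexx andbT.
      by have := e3 n; have := e0 n; lra.
  + move=> t tI; rewrite derive1E; apply: derive_val.
    by apply: dF; apply: (@Ioo n); exact: (subset_itv_oo_cc tI).
apply: ereal_nondecreasing_is_cvgn => m n mn.
apply: ge0_subset_integral; [exact: measurable_itv|exact: measurable_itv|..].
+ by apply/measurable_EFinP; apply: measurable_funS mf => // t /Ioo.
+ by move=> t /Ioo /f0; rewrite lee_fin.
+ by apply: subset_itv; rewrite bnd_simp; have := ele _ _ mn; lra.
Unshelve. all: by end_near. Qed.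

Lemma continuous_at_powR (r : R) t : 0 < t -> {for t, continuous (fun x => x `^ r)}.
Proof.
move=> t0; have [+ _] := is_derive1_powR r t0.
by rewrite derivable1_diffP; exact: differentiable_continuous.
Qed.

(* The antiderivative is [-+ |s - t|^(1 - A) / (1 - A)] on either side of [s]. *)
Lemma integral_powR_dist_le a b s A : 0 <= A < 1 -> s \in `[a, b] ->
  (\int[mu]_(t in `[a, b]) (`|s - t| `^ (- A))%:E <=
    (4 * ((b - a) `^ (1 - A) / (1 - A)))%:E)%E.
Proof.
move=> /andP[A0 A1]; rewrite in_itv/= => /andP[as_ sb].
have B0 : 0 < 1 - A by rewrite subr_gt0.
set M := _ / _.
have M0 : 0 <= M by rewrite divr_ge0 ?powR_ge0 ?ltW.
have mf : measurable_fun [set: R] (fun t => (`|s - t| `^ (- A))%:E).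
  apply/measurable_EFinP; apply: (measurableT_comp (measurable_powR _)).
  apply: measurableT_comp => //; exact: measurable_funB.
have f0 t : (0 <= (`|s - t| `^ (- A))%:E)%E by rewrite lee_fin powR_ge0.
(* The sign [k] of [t - s] treats both sides of [s] at once. Each side contributes [2 * M], whence
   the factor 4. *)
have side (k : R) c d : k ^+ 2 = 1 -> a <= c -> d <= b ->
    {in `]c, d[, forall t, 0 < k * (t - s)} ->
    (\int[mu]_(t in `]c, d[) (`|s - t| `^ (- A))%:E <= (2 * M)%:E)%E.
  move=> k2 ac db kt.
  have nk : `|k| = 1.
    by apply/eqP; rewrite -sqrp_eq1// -normrX k2 normr1.
  have distE t : t \in `]c, d[ -> `|s - t| = k * (t - s).
    by move=> /kt /gtr0_norm <-; rewrite normrM nk mul1r distrC.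
  apply: (@ge0_integral_oo_le _ (fun t => k * (1 - A)^-1 * (k * (t - s)) `^ (1 - A))) => //.
  - move=> t tcd; have kt0 := kt t tcd.
    apply: (@continuous_comp _ _ _ (fun t => `|s - t|) (fun x => x `^ (- A))).
      apply: (@continuous_comp _ _ _ (fun t => s - t) Num.norm).
        by apply: cvgB; [exact: cvg_cst|exact: cvg_id].
      exact: norm_continuous.
    by apply: continuous_at_powR; rewrite distE.
  - move=> t tcd; rewrite distE//; have kt0 := kt t tcd.
    have dk : is_derive t 1 (fun x => k * (x - s)) k.
      by apply: is_derive_eq; rewrite subr0 /GRing.scale/= mulr1.
    have dp := @is_derive1_comp _ (fun x => x `^ (1 - A)) (fun x => k * (x - s))
      t _ _ (is_derive1_powR (1 - A) kt0) dk.
    apply: (@is_derive_eq _ _ _ _ _ _ _ _ (@is_deriveZ _ _ _ _ (k * (1 - A)^-1) _ _ _ dp)).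
    rewrite /GRing.scale/= addrAC subrr add0r.
    transitivity (k ^+ 2 * (k * (t - s)) `^ (- A)); last by rewrite k2 mul1r.
    by field; rewrite gt_eqF.
  - move=> t tcd; have kt0 := kt t tcd.
    rewrite normrM normrM nk mul1r gtr0_norm ?invr_gt0// mulrC.
    rewrite ger0_norm ?powR_ge0// ler_pM2r ?invr_gt0//.
    apply: ge0_ler_powR; rewrite ?nnegrE ?(ltW B0) ?(ltW kt0) ?subr_ge0 ?(le_trans as_)//.
    rewrite -distE//; move: tcd; rewrite in_itv/= => /andP[ct td].
    by rewrite ler_norml; lra.
have sab : `[a, b]%classic = `[a, s[%classic `|` `[s, b]%classic.
  by rewrite -itv_bndbnd_setU.
rewrite sab ge0_integral_setU//=; last 2 first.
- exact: measurable_funS mf.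
- by apply/disj_setPS => t []/=; rewrite !in_itv/= => /andP[_ ts] /andP[]; rewrite leNgt ts.
rewrite (_ : 4 * M = 2 * M + 2 * M); last by ring.
rewrite EFinD; apply: leeD.
- rewrite integral_itv_bndoo; last exact: measurable_funS mf.
  apply: (side (-1)); rewrite ?sqrrN ?expr1n// => t; rewrite in_itv/= => /andP[_].
  by rewrite mulN1r oppr_gt0 subr_lt0.
- rewrite integral_itv_bndoo; last exact: measurable_funS mf.
  apply: (side 1); rewrite ?expr1n// => t; rewrite in_itv/= => /andP[+ _].
  by rewrite mul1r subr_gt0.
Qed.

End SingularIntegrals.

(** * Measurability and Fubini's theorem on rectangles *)

Section Plane.
Context {R : realType}.
Notation mu := (@lebesgue_measure R).
Implicit Types (a b c d s t B : R) (f : R * R -> R).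

(** Second countability: [U] is the union of the boxes with rational corners that it contains.
    Intersecting each box with a set that is everything or nothing, according to whether the box
    lies in [U], lets the union run over a plainly countable type. *)
Lemma open_measurable_prod (U : set (R * R)) : open U ->
  measurable (U : set (measurableTypeR R * measurableTypeR R)).
Proof.
move=> oU.
pose itv (q : rat * rat) : set R := `](ratr q.1 : R), (ratr q.2 : R)[%classic.
pose box (q : (rat * rat) * (rat * rat)) : set (R * R) := itv q.1 `*` itv q.2.
have -> : U = \bigcup_q (box q `&` [set _ | box q `<=` U]).
  apply/seteqP; split=> [[x y] Uxy|p [q _] [qp]]; last exact.
  have : nbhs (x, y) U by exact: open_nbhs_nbhs.
  move=> /nbhs_ballP[e /= e0 eU].
  have dense (z : R) : exists q, itv q z /\ itv q `<=` ball z e.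
    have [p] := @rat_in_itvoo R (z - e) z ltac:(by rewrite ltrBlDr ltrDl).
    have [q] := @rat_in_itvoo R z (z + e) ltac:(by rewrite ltrDl).
    rewrite !in_itv/= => /andP[zq qe] /andP[ep pz].
    exists (p, q); split; first by rewrite /itv/= in_itv/= pz.
    move=> u; rewrite /itv/= in_itv/= => /andP[pu uq].
    by rewrite /ball/= ltr_norml; lra.
  have [q1 [q1x q1e]] := dense x; have [q2 [q2y q2e]] := dense y.
  exists (q1, q2) => //; split; first by split.
  by move=> [u v] [/= /q1e ub /q2e vb]; apply: eU.
apply: countable_bigcupT_measurable; first exact: countableP.
move=> q; have [qU|qU] := pselect (box q `<=` U).
  rewrite (_ : [set _ | box q `<=` U] = setT) ?setIT; last by apply/seteqP; split.
  by apply: measurableX; exact: measurable_itv.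
rewrite (_ : [set _ | box q `<=` U] = set0) ?setI0; last by apply/seteqP; split.
exact: measurable0.
Qed.

Lemma continuous_measurable_prod f : continuous f ->
  measurable_fun [set: measurableTypeR R * measurableTypeR R] f.
Proof.
move=> cf; apply: (measurability _ (RGenOInfty.measurableE R)).
move=> _ [_ [x ->] <-]; apply: measurableI => //.
by apply: open_measurable_prod; apply: open_comp => // p _; exact: cf.
Qed.

(** The bound at fixed [t] gives integrability over the rectangle by Tonelli's theorem. The two
    bounds together make the inner integrals finite, so that nothing is lost in [Rintegral], which
    sends an infinite integral to 0. *)
Lemma Rintegral_Fubini f a b c d B :
  measurable_fun [set: measurableTypeR R * measurableTypeR R] f ->
  (forall t, t \in `[a, b] ->
    (\int[mu]_(s in `[c, d]) `|f (t, s)|%:E <= B%:E)%E) ->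
  (forall s, s \in `[c, d] ->
    (\int[mu]_(t in `[a, b]) `|f (t, s)|%:E <= B%:E)%E) ->
  \int[mu]_(t in `[a, b]) \int[mu]_(s in `[c, d]) f (t, s) =
  \int[mu]_(s in `[c, d]) \int[mu]_(t in `[a, b]) f (t, s).
Proof.
move=> mf fB1 fB2.
pose D1 := `[a, b]%classic; pose D2 := `[c, d]%classic.
have mD1 : measurable D1 by exact: measurable_itv.
have mD2 : measurable D2 by exact: measurable_itv.
have secE1 (h : R * R -> \bar R) t : (\int[mu]_s (h \_ (D1 `*` D2)) (t, s) =
    ((fun t => \int[mu]_(s in D2) h (t, s)) \_ D1) t)%E.
  rewrite patchE; case: ifPn => tD.
    by rewrite [RHS]integral_mkcond; apply: eq_integral => s _; rewrite !patchE/= in_setX tD.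
  by apply: integral0_eq => s _; rewrite patchE/= in_setX (negbTE tD).
have secE2 (h : R * R -> \bar R) s : (\int[mu]_t (h \_ (D1 `*` D2)) (t, s) =
    ((fun s => \int[mu]_(t in D1) h (t, s)) \_ D2) s)%E.
  rewrite patchE; case: ifPn => sD.
    by rewrite [RHS]integral_mkcond; apply: eq_integral => t _; rewrite !patchE/= in_setX sD andbT.
  by apply: integral0_eq => t _; rewrite patchE/= in_setX (negbTE sD) andbF.
have mG : measurable_fun [set: measurableTypeR R * measurableTypeR R]
    ((EFin \o f) \_ (D1 `*` D2)).
  apply/(measurable_restrict _ _ _) => //; first exact: measurableX.
  rewrite setTI; apply/measurable_EFinP; exact: measurable_funS mf.
have mft (t : R) : measurable_fun setT (fun s : R => f (t, s)).
  exact: (measurableT_comp mf (pair1_measurable t)).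
have mfs (s : R) : measurable_fun setT (fun t : R => f (t, s)).
  exact: (measurableT_comp mf (pair2_measurable s)).
have int1 t : t \in `[a, b] -> mu.-integrable D2 (EFin \o (fun s => f (t, s))).
  move=> tab; apply/integrableP; split.
    by apply/measurable_EFinP; apply: measurable_funS (mft t).
  by apply: le_lt_trans (fB1 t tab) _; rewrite ltry.
have int2 s : s \in `[c, d] -> mu.-integrable D1 (EFin \o (fun t => f (t, s))).
  move=> scd; apply/integrableP; split.
    by apply/measurable_EFinP; apply: measurable_funS (mfs s).
  by apply: le_lt_trans (fB2 s scd) _; rewrite ltry.
have intG : (mu \x mu)%E.-integrable [set: measurableTypeR R * measurableTypeR R]
    ((EFin \o f) \_ (D1 `*` D2)).
  apply/integrable12ltyP => //.
  have absG : (fun p => `|((EFin \o f) \_ (D1 `*` D2)) p|%E) =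
      (fun p => `|(f p)%:E|%E) \_ (D1 `*` D2).
    by apply/funext => p; rewrite !patchE; case: ifP => //; rewrite abse0.
  apply: (@le_lt_trans _ _ (\int[mu]_t ((cst B%:E) \_ D1) t)%E).
    apply: ge0_le_integral => //.
    - by move=> t _; exact: integral_ge0.
    - apply: (@measurable_fun_fubini_tonelli_F _ _ _ _ _ mu
        (fun p => `|((EFin \o f) \_ (D1 `*` D2)) p|%E)) => //.
      exact: measurableT_comp.
    - by apply/(measurable_restrict _ _ _) => //; rewrite setTI.
    - move=> t _; under eq_integral => s _ do rewrite (congr1 (@^~ (t, s)) absG).
      rewrite secE1 !patchE; case: ifPn => //; rewrite inE; exact: fB1.
  rewrite -integral_mkcond integral_cst//= lebesgue_measure_itv/=.
  by case: ifP => _; rewrite ?mule0 -?EFinB -?EFinM ltry.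
rewrite /Rintegral.
under eq_integral => t tD.
  rewrite fineK; last by apply: integrable_fin_num => //; apply: int1; rewrite inE in tD.
  over.
under [in RHS]eq_integral => s sD.
  rewrite fineK; last by apply: integrable_fin_num => //; apply: int2; rewrite inE in sD.
  over.
rewrite integral_mkcond [in RHS]integral_mkcond; congr fine.
under eq_integral => t _ do rewrite -(secE1 (EFin \o f)).
under [in RHS]eq_integral => s _ do rewrite -(secE2 (EFin \o f)).
exact: Fubini.
Qed.

End Plane.

(** * Weakly singular kernels and their truncation near the diagonal *)

Section WeaklySingularKernels.
Context {R : realType}.
Notation mu := (@lebesgue_measure R).
Implicit Types (a b c d s t A C M delta : R) (y u v : R -> R) (K : R -> R -> R).

(* The condition on the diagonal, immaterial for integrals, makes the truncations
   [cutoff] below converge to [K] everywhere. *)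
Definition weakly_singular a b K : Prop :=
  [/\ exists C A, [/\ 0 <= C, 0 <= A < 1 & forall t s, t \in `[a, b] ->
        s \in `[a, b] -> `|K t s| <= C * `|t - s| `^ (- A)],
      forall t, K t t = 0 &
      forall t s, t != s -> {for (t, s), continuous (fun p : R * R => K p.1 p.2)}].

Lemma weakly_singular_tr a b K :
  weakly_singular a b K -> weakly_singular a b (fun t s => K s t).
Proof.
move=> [[C [A [C0 A01 KC]]] K0 cK]; split=> //.
  by exists C, A; split=> // t s tab sab; rewrite distrC; exact: KC.
move=> t s ts.
apply: (@continuous_comp _ _ _ (fun p : R * R => (p.2, p.1)) (fun p => K p.1 p.2)).
  exact: (cvg_pair cvg_snd cvg_fst).
by apply: cK; rewrite eq_sym.
Qed.

(** The factor is a ramp in [|t - s|], equal to 0 up to [delta / 2] and to 1 from [delta] on.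
    Vanishing in a whole neighbourhood of the diagonal makes the truncated kernel continuous there,
    however [K] behaves. *)
Definition cutoff delta K t s : R :=
  clamp 0 1 (2 * `|t - s| / delta - 1) * K t s.

Lemma cutoff_far delta K t s : 0 < delta -> delta <= `|t - s| ->
  cutoff delta K t s = K t s.
Proof.
move=> d0 dts; rewrite /cutoff /clamp.
have h : 1 <= 2 * `|t - s| / delta - 1.
  by rewrite lerBrDr ler_pdivlMr//; lra.
by rewrite (min_idPl h) (max_idPr ler01) mul1r.
Qed.

Lemma cutoff_near delta K t s : 0 < delta -> `|t - s| <= delta / 2 ->
  cutoff delta K t s = 0.
Proof.
move=> d0 dts; rewrite /cutoff /clamp.
have h : 2 * `|t - s| / delta - 1 <= 0.
  by rewrite lerBlDr add0r ler_pdivrMr//; lra.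
by rewrite (min_idPr (le_trans h ler01)) (max_idPl h) mul0r.
Qed.

Lemma continuous_dist : continuous (fun p : R * R => `|p.1 - p.2|).
Proof.
move=> p; apply: (@continuous_comp _ _ _ (fun p : R * R => p.1 - p.2) Num.norm).
  by apply: cvgB; [exact: cvg_fst|exact: cvg_snd].
exact: norm_continuous.
Qed.

Lemma continuous_cutoff delta a b K : 0 < delta -> weakly_singular a b K ->
  continuous (fun p : R * R => cutoff delta K p.1 p.2).
Proof.
move=> d0 [_ _ cK] [t s]; have [<-|ts] := eqVneq t s.
  rewrite /continuous_at /= cutoff_near ?subrr ?normr0 ?divr_ge0 ?ltW//.
  apply/cvgrPdist_lt => e e0.
  have /cvgrPdist_lt /(_ (delta / 2)) := @continuous_dist (t, t).
  rewrite divr_gt0// => /(_ isT); apply: filterS => p /=.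
  rewrite subrr normr0 sub0r normrN normr_id => pd.
  by rewrite cutoff_near ?subrr ?normr0// ltW.
apply: cvgM; last exact: cK.
apply: (@continuous_comp _ _ _ (fun p : R * R => 2 * `|p.1 - p.2| / delta - 1)
  (clamp 0 1)); last exact: continuous_clamp.
apply: cvgB; last exact: cvg_cst.
apply: cvgM; last exact: cvg_cst.
by apply: cvgM; [exact: cvg_cst|exact: continuous_dist].
Qed.

Lemma measurable_weakly_singular a b K : weakly_singular a b K ->
  measurable_fun [set: measurableTypeR R * measurableTypeR R]
    (fun p => K p.1 p.2).
Proof.
move=> wK; have [_ K0 _] := wK.
apply: (@measurable_fun_cvg _ _ _ _ (fun n p => cutoff n.+1%:R^-1 K p.1 p.2)).
  by move=> n; apply: continuous_measurable_prod; apply: continuous_cutoff wK; rewrite invr_gt0.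
move=> [t s] _ /=; have [<-|ts] := eqVneq t s.
  rewrite (_ : (fun n => _) = cst 0); first by rewrite K0; exact: cvg_cst.
  by apply/funext => n; rewrite cutoff_near// subrr normr0.
have ts0 : 0 < `|t - s| by rewrite normr_gt0 subr_eq0.
apply: cvg_near_cst; near=> n; rewrite cutoff_far// ltW//; near: n.
exact: (near_infty_natSinv_lt (PosNum ts0)).
Unshelve. all: by end_near. Qed.

Lemma integral_le_powR_dist (f : R -> R) a b c d t C A :
  measurable_fun setT f -> 0 <= C -> 0 <= A < 1 -> t \in `[a, b] ->
  a <= c -> d <= b ->
  (forall s, s \in `[c, d] -> `|f s| <= C * `|t - s| `^ (- A)) ->
  (\int[mu]_(s in `[c, d]) `|f s|%:E <=
    (C * (4 * ((b - a) `^ (1 - A) / (1 - A))))%:E)%E.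
Proof.
move=> mf C0 A01 tab ac db fC.
have mD : measurable_fun [set: R] (fun s => `|t - s| `^ (- A)).
  apply: (measurableT_comp (measurable_powR _)).
  apply: measurableT_comp => //; exact: measurable_funB.
apply: (@le_trans _ _ (\int[mu]_(s in `[c, d]) (C%:E * (`|t - s| `^ (- A))%:E))%E).
  apply: ge0_le_integral => //.
  - apply/measurable_EFinP; apply: measurableT_comp => //.
    exact: measurable_funS mf.
  - apply/measurable_EFinP; apply: measurable_funM => //.
    exact: measurable_funS mD.
rewrite ge0_integralZl//; last first.
  by apply/measurable_EFinP; exact: measurable_funS mD.
rewrite EFinM; apply: lee_wpmul2l; first by rewrite lee_fin.
apply: le_trans (integral_powR_dist_le A01 tab).
apply: ge0_subset_integral => //; last by apply: subset_itv; rewrite bnd_simp.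
by apply/measurable_EFinP; exact: measurable_funS mD.
Qed.

End WeaklySingularKernels.

(** * Integral operators with weakly singular kernels: continuity and adjoints *)

Section IntegralOperators.
Context {R : realType}.
Notation mu := (@lebesgue_measure R).
Implicit Types (a b c d s t A C M delta : R) (y u v : R -> R) (K : R -> R -> R).

Lemma continuous_bounded_itv y a b : continuous y ->
  exists2 M, 0 <= M & forall t, t \in `[a, b] -> `|y t| <= M.
Proof.
move=> cy; have [ab|ba] := leP a b; last first.
  by exists 0 => // t; rewrite in_itv/= => /andP[/le_trans/[apply]]; rewrite leNgt ba.
have cny : {within `[a, b], continuous (fun t => `|y t|)}.
  apply: continuous_subspaceT => t.
  by apply: (@continuous_comp _ _ _ y Num.norm); [exact: cy|exact: norm_continuous].
have [c _ cM] := EVT_max ab cny.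
by exists `|y c|.
Qed.

Definition integral_op K c d y t : R := \int[mu]_(s in `[c, d]) (K t s * y s).

Section WeaklySingular.
Variables (a b : R) (K : R -> R -> R).
Hypothesis wK : weakly_singular a b K.

Let mKl t : measurable_fun setT (fun s : R => K t s).
Proof.
exact: (measurableT_comp (measurable_weakly_singular wK) (pair1_measurable t)).
Qed.

Lemma weakly_singular_bound y : continuous y ->
  exists B, forall t c d, t \in `[a, b] -> a <= c -> d <= b ->
    (\int[mu]_(s in `[c, d]) `|K t s * y s|%:E <= B%:E)%E.
Proof.
move=> cy; have [M M0 yM] := continuous_bounded_itv a b cy.
have [[C [A [C0 A01 KC]]] _ _] := wK.
eexists => t c d tab ac db.
apply: (@integral_le_powR_dist _ _ a b c d t (C * M) A) => //.
- by apply: measurable_funM => //; exact: continuous_measurable_fun.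
- exact: mulr_ge0.
- move=> s; rewrite in_itv/= => /andP[cs sd].
  have sab : s \in `[a, b] by rewrite in_itv/= (le_trans ac) ?(le_trans sd).
  by rewrite normrM mulrAC ler_pM// ?yM// KC.
Qed.

Lemma weakly_singular_integrable y t c d : continuous y -> t \in `[a, b] ->
  a <= c -> d <= b -> mu.-integrable `[c, d] (EFin \o (fun s => K t s * y s)).
Proof.
move=> cy tab ac db; have [B HB] := weakly_singular_bound cy.
apply/integrableP; split; last by rewrite (le_lt_trans (HB t c d _ _ _)) ?ltry.
apply/measurable_EFinP; apply: measurable_funM; last first.
  by apply: measurable_funS (continuous_measurable_fun cy).
exact: measurable_funS (mKl t).
Qed.

Lemma integral_op_cutoff y : continuous y ->
  exists C r, 0 < r /\ forall delta t c d, 0 < delta -> t \in `[a, b] ->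
    a <= c -> d <= b ->
    `|integral_op K c d y t - integral_op (cutoff delta K) c d y t| <=
      C * delta `^ r.
Proof.
move=> cy; have [M M0 yM] := continuous_bounded_itv a b cy.
have [[C [A [C0 /andP[A0 A1] KC]]] K0 _] := wK.
(* Half of the gap between [A] and 1 is spent on smallness: the two kernels differ only where
   [|t - s| < delta], and there [|t - s| ^ -A <= delta ^ r * |t - s| ^ -(A + r)], still integrable
   because [A + r < 1]. *)
pose r := (1 - A) / 2.
have r0 : 0 < r by rewrite divr_gt0// subr_gt0.
have Ar1 : 0 <= A + r < 1 by rewrite /r; lra.
pose W := 4 * ((b - a) `^ (1 - (A + r)) / (1 - (A + r))).
exists (C * M * W), r; split=> // delta t c d d0 tab ac db.
have intK := weakly_singular_integrable cy tab ac db.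
have cKd : continuous (fun s => cutoff delta K t s).
  apply: (continuous_comp_pair (u := cst t) (v := id) (continuous_cutoff d0 wK)) => x.
  - exact: cvg_cst.
  - exact: cvg_id.
have intKd : mu.-integrable `[c, d] (EFin \o (fun s => cutoff delta K t s * y s)).
  by apply: continuous_integrable_itv => s; apply: cvgM; [exact: cKd|exact: cy].
rewrite /integral_op -RintegralB//.
have mf : measurable_fun setT (fun s => K t s * y s - cutoff delta K t s * y s).
  apply: measurable_funB; apply: measurable_funM => //.
  - exact: continuous_measurable_fun.
  - exact: continuous_measurable_fun.
  - exact: continuous_measurable_fun.
rewrite -lee_fin.
apply: (@le_trans _ _ (\int[mu]_(s in `[c, d]) `|K t s * y s - cutoff delta K t s * y s|%:E)%E).
  rewrite EFin_normr_Rintegral//; last first.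
    have : mu.-integrable `[c, d] (fun s =>
      (K t s * y s)%:E - (cutoff delta K t s * y s)%:E)%E by exact: integrableB.
    by [].
  by apply: le_abse_integral => //; apply/measurable_EFinP; exact: measurable_funS mf.
rewrite (_ : C * M * W * _ = (C * M * delta `^ r) * W); last by ring.
apply: (@integral_le_powR_dist _ _ a b c d t (C * M * delta `^ r) (A + r)) => //.
  by rewrite !mulr_ge0// powR_ge0.
move=> s; rewrite in_itv/= => /andP[cs sd].
have sab : s \in `[a, b] by rewrite in_itv/= (le_trans ac) ?(le_trans sd).
rewrite -mulrBl normrM.
have [dts|tsd] := leP delta `|t - s|.
  by rewrite cutoff_far// subrr normr0 mul0r !mulr_ge0// powR_ge0.
rewrite (_ : _ * _ * _ * _ = (C * (delta `^ r * `|t - s| `^ (- (A + r)))) * M); last by ring.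
apply: ler_pM => //; last exact: yM.
have [<-|ts] := eqVneq t s.
  have -> : cutoff delta K t t = 0.
    by rewrite cutoff_near// subrr normr0 divr_ge0// ltW.
  rewrite K0 subrr [in X in X <= _]normr0; apply: mulr_ge0 => //.
  by apply: mulr_ge0; exact: powR_ge0.
have ts0 : 0 < `|t - s| by rewrite normr_gt0 subr_eq0.
apply: (@le_trans _ _ `|K t s|).
  rewrite /cutoff -[X in X - _]mul1r -mulrBl normrM ler_piMl//.
  have := clamp_in (2 * `|t - s| / delta - 1) (@ler01 R).
  by rewrite in_itv/= ler_norml => /andP[]; lra.
apply: (le_trans (KC _ _ tab sab)); apply: ler_wpM2l => //.
apply: (@le_trans _ _ (`|t - s| `^ r * `|t - s| `^ (- (A + r)))).
  by rewrite -powRD ?(gt_eqF ts0) ?implybT// opprD addrCA subrr addr0.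
by rewrite ler_wpM2r ?powR_ge0// ge0_ler_powR ?nnegrE ?ltW.
Qed.

(** A uniform limit of continuous functions: truncating the kernel costs at most [C * delta ^ r],
    whatever [t] in [[a, b]], and the truncated kernel is jointly continuous. *)
Lemma continuous_integral_op y c d : continuous y -> a <= c -> d <= b ->
  {within `[a, b], continuous (integral_op K c d y)}.
Proof.
move=> cy ac db; have [C [r [r0 HC]]] := integral_op_cutoff cy.
apply/subspace_continuousP => t tab; apply/cvgrPdist_lt => e e0.
have e30 : 0 < e / 3 by rewrite divr_gt0.
have [delta d0 dC] : exists2 delta, 0 < delta & C * delta `^ r < e / 3.
  have H : C * x `^ r @[x --> 0^'+] --> C * 0.
    by apply: cvgM; [exact: cvg_cst|exact: powR_cvg0].
  move: H; rewrite mulr0 => /cvgrPdist_lt /(_ _ e30) H.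
  near (0:R)^'+ => x; exists x; first by near: x; exact: nbhs_right_gt.
  have : `|0 - C * x `^ r| < e / 3 by near: x.
  by rewrite sub0r normrN ltr_norml => /andP[].
have cKd : continuous (fun p : R * R => cutoff delta K p.1 p.2 * y p.2).
  move=> p; apply: cvgM; first exact: (continuous_cutoff d0 wK).
  by apply: (@continuous_comp _ _ _ snd y); [exact: cvg_snd|exact: cy].
have := @continuous_Rintegral_param _ _ (fun t s => cutoff delta K t s * y s) c d cKd t.
move=> /cvgrPdist_lt /(_ _ e30); rewrite near_withinE; apply: filterS => s /= ts sab.
rewrite -[from_subspace _ _ t]/(integral_op K c d y t).
rewrite -[from_subspace _ _ s]/(integral_op K c d y s).
have := HC delta t c d d0 tab ac db; have := HC delta s c d d0 sab ac db.
rewrite -/(integral_op (cutoff delta K) c d y t) in ts.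
rewrite -/(integral_op (cutoff delta K) c d y s) in ts.
move: ts; move: (integral_op _ _ _ _ t) (integral_op _ _ _ _ s) => F G FG.
move: (integral_op _ _ _ _ s) (integral_op _ _ _ _ t) => F' G' F'G G'F.
rewrite (_ : G' - F' = (G' - F) + (F - G) - (F' - G)); last by ring.
apply: (le_lt_trans (ler_normB _ _)).
have := ler_normD (G' - F) (F - G); lra.
Unshelve. all: by end_near. Qed.

End WeaklySingular.

(** The adjoint of an integral operator has the transposed kernel. This stands in for fractional
    integration by parts: it moves the operator off the direction without differentiating
    anything. *)
Lemma Fubini_integral_op a b K u v c d c' d' : weakly_singular a b K ->
  continuous u -> continuous v -> a <= c -> d <= b -> a <= c' -> d' <= b ->
  \int[mu]_(t in `[c, d]) (u t * integral_op K c' d' v t) =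
  \int[mu]_(s in `[c', d']) (v s * integral_op (fun t s => K s t) c d u s).
Proof.
move=> wK cu cv ac db ac' db'.
have wK' := weakly_singular_tr wK.
have sub x z s : a <= x -> z <= b -> s \in `[x, z] -> s \in `[a, b].
  by move=> ax zb; rewrite !in_itv/= => /andP[xs sz]; rewrite (le_trans ax) ?(le_trans sz).
have sub1 t : t \in `[c, d] -> t \in `[a, b] by exact: sub.
have sub2 s : s \in `[c', d'] -> s \in `[a, b] by exact: sub.
have [Mu Mu0 uM] := continuous_bounded_itv a b cu.
have [Mv Mv0 vM] := continuous_bounded_itv a b cv.
have [B1 HB1] := weakly_singular_bound wK cv.
have [B2 HB2] := weakly_singular_bound wK' cu.
have mK := measurable_weakly_singular wK.
transitivity (\int[mu]_(t in `[c, d]) \int[mu]_(s in `[c', d']) (u t * (K t s * v s))).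
  apply: eq_Rintegral => t; rewrite inE/= => /sub1 tab.
  by rewrite RintegralZl//; exact: (weakly_singular_integrable wK).
transitivity (\int[mu]_(s in `[c', d']) \int[mu]_(t in `[c, d]) (u t * (K t s * v s))); last first.
  apply: eq_Rintegral => s; rewrite inE/= => /sub2 sab.
  rewrite -RintegralZl//; last exact: (weakly_singular_integrable wK').
  by apply: eq_Rintegral => t _; ring.
have mu1 : measurable_fun [set: measurableTypeR R * measurableTypeR R] (fun p => u p.1).
  apply: continuous_measurable_prod => p.
  by apply: (@continuous_comp _ _ _ fst u); [exact: cvg_fst|exact: cu].
have mv2 : measurable_fun [set: measurableTypeR R * measurableTypeR R] (fun p => v p.2).
  apply: continuous_measurable_prod => p.
  by apply: (@continuous_comp _ _ _ snd v); [exact: cvg_snd|exact: cv].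
have scale (w : R -> R) (k M B : R) x z : 0 <= M -> `|k| <= M -> measurable_fun setT w ->
    (\int[mu]_(s in `[x, z]) `|w s|%:E <= B%:E)%E ->
    (\int[mu]_(s in `[x, z]) `|k * w s|%:E <= (M * B)%:E)%E.
  move=> M0 kM mw wB.
  under eq_integral => s _ do rewrite normrM EFinM.
  rewrite ge0_integralZl//; last first.
    apply/measurable_EFinP; apply: measurableT_comp => //.
    exact: measurable_funS mw.
  by rewrite EFinM; apply: lee_pmul => //; exact: integral_ge0.
apply: (@Rintegral_Fubini _ (fun p => u p.1 * (K p.1 p.2 * v p.2)) c d c' d'
  (Num.max (Mu * B1) (Mv * B2))).
- by apply: measurable_funM => //; exact: measurable_funM.
- move=> t /sub1 tab /=.
  apply: (@le_trans _ _ (Mu * B1)%:E); last by rewrite lee_fin le_max lexx.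
  apply: scale => //; first exact: uM.
    by apply: measurable_funM; [exact: (measurableT_comp mK (pair1_measurable t))|
      exact: continuous_measurable_fun].
  exact: HB1.
- move=> s /sub2 sab /=.
  apply: (@le_trans _ _ (Mv * B2)%:E); last by rewrite lee_fin le_max lexx orbT.
  under eq_integral => t _ do rewrite mulrA mulrC [u t * _]mulrC.
  apply: scale => //; first exact: vM.
    by apply: measurable_funM; [exact: (measurableT_comp mK (pair2_measurable s))|
      exact: continuous_measurable_fun].
  exact: HB2.
Qed.

End IntegralOperators.

(** * Positivity and continuity of Gamma on []0, 1[], where the values [1 - al] lie *)

Section GammaFunction.
Context {R : realType}.
Notation mu := (@lebesgue_measure R).
Implicit Types (s x m : R).

Let gamma_fun s x : R := x `^ (s - 1) * expR (- x).

Lemma measurable_gamma_integrand s : measurable_fun setT (gamma_fun s).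
Proof.
apply: measurable_funM; first exact: measurable_powR.
by apply: measurableT_comp => //; exact: measurableT_comp.
Qed.

Lemma continuous_gamma_integrand x : 0 < x -> continuous (gamma_fun ^~ x).
Proof.
move=> x0 s; apply: cvgM; last exact: cvg_cst.
rewrite (_ : (fun s => _) = (fun s => expR ((s - 1) * ln x))); last first.
  by apply/funext => z; rewrite /powR gt_eqF.
rewrite /powR gt_eqF//.
apply: (@continuous_comp _ _ _ (fun s => (s - 1) * ln x) expR).
  apply: cvgM; last exact: cvg_cst.
  by apply: cvgB; [exact: cvg_id|exact: cvg_cst].
exact: continuous_expR.
Qed.

(** One dominating function serves all [s] in []m, 1[]: on []0, 1]] the power is at most
    [x ^ (m - 1)], and beyond 1 it is at most 1, which leaves the exponential density. *)
Lemma gamma_dominated m : 0 < m < 1 ->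
  exists2 g : R -> R, mu.-integrable `]0, +oo[ (EFin \o g) &
    forall s x, m < s < 1 -> 0 < x -> `|gamma_fun s x| <= g x.
Proof.
move=> /andP[m0 m1].
pose p x : R := `|0 - x| `^ (- (1 - m)).
have mp : measurable_fun setT p.
  apply: (measurableT_comp (measurable_powR _)).
  apply: measurableT_comp => //; exact: measurable_funB.
exists (fun x => (p \_ `[0, 1]) x + exponential_pdf 1 x).
  have intp : mu.-integrable `[0, 1] (EFin \o p).
    apply/integrableP; split; first by apply/measurable_EFinP; exact: measurable_funS mp.
    under eq_integral => x _ do rewrite /= ger0_norm ?powR_ge0//.
    apply: le_lt_trans (integral_powR_dist_le _ _) _; rewrite ?ltry//.
      by rewrite subr_ge0 ltW//= gtrBl.
    by rewrite in_itv/= lexx ler01.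
  have intp' : mu.-integrable setT (EFin \o (p \_ `[0, 1])).
    by rewrite -restrict_EFin -integrable_mkcond.
  have : mu.-integrable `]0, +oo[
      (fun x => ((p \_ `[0, 1]) x)%:E + (exponential_pdf 1 x)%:E)%E.
    apply: integrableD => //; first exact: integrableS intp'.
    exact: integrableS (integrable_exponential_pdf _).
  by [].
move=> s x /andP[ms s1] x0.
rewrite /gamma_fun ger0_norm ?mulr_ge0 ?powR_ge0 ?expR_ge0//.
rewrite exponential_pdfE ?(ltW x0)// mul1r mulN1r patchE.
have -> : (x \in `[0, 1]%classic) = (x <= 1).
  by apply/idP/idP; rewrite inE/= in_itv/= (ltW x0).
have [x1|x1] := leP x 1.
  apply: (@le_trans _ _ (p x)); last by rewrite lerDl expR_ge0.
  rewrite /p sub0r normrN gtr0_norm// opprB -[leRHS]mulr1.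
  apply: ler_pM; rewrite ?powR_ge0 ?expR_ge0 ?expR_le1 ?oppr_le0 ?(ltW x0)//.
  by apply: ger_powR; rewrite ?x0 ?x1//; lra.
(* Outside [[0, 1]] the restriction takes the default value [point], which is 0. *)
rewrite [point]/(0 : R) add0r -[leRHS]mul1r ler_wpM2r ?expR_ge0// -[leRHS](powRr0 x).
by apply: ler_powR; lra.
Qed.

Lemma integrable_gamma_integrand s : 0 < s < 1 ->
  mu.-integrable `]0, +oo[ (EFin \o gamma_fun s).
Proof.
move=> /andP[s0 s1].
have [|g intg gs] := @gamma_dominated (s / 2); first by lra.
apply: (@le_integrable _ _ _ mu _ _ _ (EFin \o g)) => //.
  by apply/measurable_EFinP; apply: measurable_funS (measurable_gamma_integrand s).
move=> x; rewrite /= in_itv/= andbT => x0.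
by rewrite lee_fin (le_trans (gs _ _ _ _))// ?ler_norm//; lra.
Qed.

Lemma Gamma_gt0 s : 0 < s < 1 -> 0 < Gamma s.
Proof.
move=> /andP[s0 s1].
have intG : mu.-integrable `]0, +oo[ (EFin \o gamma_fun s).
  by apply: integrable_gamma_integrand; rewrite s0.
(* On [[1, 2]] the power is at least [x ^ -1 >= 1 / 2] and the exponential at least [expR (- 2)];
   the interval has length 1. *)
suff : ((2^-1 * expR (- 2))%:E <= \int[mu]_(x in `]0%R, +oo[) (gamma_fun s x)%:E)%E.
  rewrite -[X in (_ <= X)%E]fineK ?integrable_fin_num// lee_fin; apply: lt_le_trans.
  by rewrite mulr_gt0 ?invr_gt0 ?expR_gt0.
apply: (@le_trans _ _ (\int[mu]_(x in `[1%R, 2%R]) (gamma_fun s x)%:E)%E).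
  apply: (@le_trans _ _ (\int[mu]_(x in `[1%R, 2%R]) (cst (2^-1 * expR (- 2))%:E x))%E).
    rewrite integral_cst//= lebesgue_measure_itv/= lte_fin ltrDl ltr01.
    by rewrite -EFinD addrK mule1.
  apply: ge0_le_integral => //.
  - by move=> x _; rewrite lee_fin mulr_ge0 ?invr_ge0 ?expR_ge0.
  - by apply/measurable_EFinP; apply: measurable_funS (measurable_gamma_integrand s).
  - move=> x /=; rewrite in_itv/= => /andP[x1 x2]; rewrite lee_fin.
    apply: ler_pM => //; rewrite ?invr_ge0 ?expR_ge0// ?ler_expR ?lerN2//.
    apply: (@le_trans _ _ (x `^ (- 1))).
      have x0 : 0 < x by exact: lt_le_trans x1.
      by rewrite powR_inv1 ?(ltW x0)// lef_pV2// posrE.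
    by apply: ler_powR => //; lra.
apply: ge0_subset_integral => //.
- by apply/measurable_EFinP; apply: measurable_funS (measurable_gamma_integrand s).
- by move=> x _; rewrite lee_fin mulr_ge0 ?powR_ge0 ?expR_ge0.
- move=> x /=; rewrite !in_itv/= andbT => /andP[x1 _]; exact: lt_le_trans x1.
Qed.

Lemma continuous_Gamma s : 0 < s < 1 -> {for s, continuous (@Gamma R)}.
Proof.
move=> /andP[s0 s1].
have m01 : 0 < s / 2 < 1 by lra.
have [g intg gs] := gamma_dominated m01.
have := @continuity_under_integral R _ _ mu gamma_fun `]0, +oo[%classic
  (measurable_itv _) (s / 2) 1.
apply => //.
- move=> x /=; rewrite in_itv/= => /andP[x0 x1].
  by apply: integrable_gamma_integrand; lra.
- apply: aeW => x /=; rewrite in_itv/= andbT => x0 z _.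
  exact: continuous_gamma_integrand.
- exact: intg.
- move=> x; rewrite /= in_itv/= => xI; apply: aeW => z /=; rewrite in_itv/= andbT => z0.
  exact: gs.
- by rewrite inE/= in_itv/=; lra.
Qed.

End GammaFunction.

(** * Kernels of variable fractional order are weakly singular *)

Section FractionalKernels.
Context {R : realType}.
Notation mu := (@lebesgue_measure R).
Implicit Types (a b c d s t A C M : R) (y u v : R -> R) (al K : R -> R -> R).

Lemma weakly_singular_lincomb a b k1 k2 K1 K2 :
  weakly_singular a b K1 -> weakly_singular a b K2 ->
  weakly_singular a b (fun t s => k1 * K1 t s + k2 * K2 t s).
Proof.
move=> [[C1 [A1 [C10 /andP[A10 A11] KC1]]] K10 cK1] [[C2 [A2 [C20 /andP[A20 A21] KC2]]] K20 cK2].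
split; last 2 first.
- by move=> t; rewrite K10 K20 !mulr0 addr0.
- move=> t s ts; apply: cvgD.
    by apply: cvgM; [exact: cvg_cst|exact: cK1].
  by apply: cvgM; [exact: cvg_cst|exact: cK2].
(* The larger exponent serves both kernels. Raising the exponent from [A'] to [A] costs
   [|t - s| ^ (A - A')], at most [D] because [D >= 1] exceeds all distances and [A - A' <= 1]. *)
pose A := Num.max A1 A2; pose D := 1 + `|b - a|.
have D1 : 1 <= D by rewrite lerDl.
have A1A : A1 <= A by rewrite le_max lexx.
have A2A : A2 <= A by rewrite le_max lexx orbT.
have A1' : A < 1 by rewrite gt_max A11.
exists (`|k1| * (C1 * D) + `|k2| * (C2 * D)), A; split.
- by rewrite addr_ge0// !mulr_ge0// (le_trans ler01).
- by rewrite A1' (le_trans A10).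
move=> t s tab sab; have [<-|ts] := eqVneq t s.
  rewrite K10 K20 !mulr0 addr0 normr0 mulr_ge0 ?powR_ge0//.
  by rewrite addr_ge0// !mulr_ge0// (le_trans ler01).
have ts0 : 0 < `|t - s| by rewrite normr_gt0 subr_eq0.
have tsD : `|t - s| <= D.
  move: tab sab; rewrite !in_itv/= /D => /andP[ta tb] /andP[sa sb].
  by have := ler_norm (b - a); rewrite ler_norml; lra.
have pow A' : 0 <= A' -> A' <= A -> `|t - s| `^ (- A') <= D * `|t - s| `^ (- A).
  move=> A'0 A'A; rewrite (_ : - A' = (A - A') - A); last by ring.
  rewrite powRD ?(gt_eqF ts0) ?implybT// ler_wpM2r ?powR_ge0//.
  apply: (@le_trans _ _ (D `^ (A - A'))).
    by rewrite ge0_ler_powR ?nnegrE ?subr_ge0// ?(ltW ts0)// (le_trans ler01).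
  by apply: ler1_powR => //; lra.
rewrite (le_trans (ler_normD _ _))// mulrDl !normrM -!mulrA lerD// ler_wpM2l//.
- by rewrite (le_trans (KC1 _ _ tab sab))// ler_wpM2l// pow.
- by rewrite (le_trans (KC2 _ _ tab sab))// ler_wpM2l// pow.
Qed.

Lemma compact_continuous_ubound (T : topologicalType) (D : set T) (f : T -> R) :
  compact D -> continuous f -> exists2 M, 0 < M & forall x, D x -> f x <= M.
Proof.
move=> cD cf.
have /compact_bounded[M [_ HM]] := continuous_compact (continuous_subspaceT cf) cD.
exists (Num.max 0 M + 1).
  by rewrite ltr_pwDr// le_max lexx.
move=> x Dx; apply: le_trans (ler_norm _) _.
apply: HM; last by exists x.
by rewrite ltr_pwDr// le_max lexx orbT.
Qed.

Section Order.
Variables (a b : R) (al : R -> R -> R).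
Hypotheses (ab : a < b) (hal : fractional_order a b al).

Let al' (p : R * R) := al (clamp a b p.1) (clamp a b p.2).

Let continuous_al' : continuous al'.
Proof.
have c1 : continuous (clamp a b \o (@fst R R)).
  by move=> q; apply: continuous_comp; [exact: cvg_fst|exact: continuous_clamp].
have c2 : continuous (clamp a b \o (@snd R R)).
  by move=> q; apply: continuous_comp; [exact: cvg_snd|exact: continuous_clamp].
apply: (within_continuous_comp (r := fun p => (clamp a b p.1, clamp a b p.2)) hal.1).
  by move=> q; exact: (cvg_pair (c1 q) (c2 q)).
by move=> p; split=> /=; exact: clamp_in (ltW ab).
Qed.

Let al'01 p : 0 < al' p < 1.
Proof. by apply: hal.2; exact: clamp_in (ltW ab). Qed.

Let invGamma (p : R * R) := (Gamma (1 - al' p))^-1.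

Let Gamma_al'_gt0 p : 0 < Gamma (1 - al' p).
Proof. by apply: Gamma_gt0; have := al'01 p; lra. Qed.

Let continuous_invGamma : continuous invGamma.
Proof.
move=> p; apply: cvgV; first by rewrite gt_eqF.
apply: (@continuous_comp _ _ _ (fun p => 1 - al' p) (@Gamma R)).
  by apply: cvgB; [exact: cvg_cst|exact: continuous_al'].
by apply: continuous_Gamma; have := al'01 p; lra.
Qed.

(* [left_kernel], extended by [0] above the diagonal; the right operators use its
   transpose. *)
Definition frac_kernel t s : R :=
  if s < t then (t - s) `^ (- al' (t, s)) * invGamma (t, s) else 0.

(** The strict comparison in [frac_kernel] and the large one here agree on the diagonal because
    [powR] sends 0 to 0 for every nonzero exponent, even a negative one. *)
Lemma frac_kernelE t s : t \in `[a, b] -> s \in `[a, b] ->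
  frac_kernel t s = if s <= t then left_kernel al t s else 0.
Proof.
move=> tab sab; rewrite /frac_kernel /left_kernel /invGamma /al'/= !clamp_id//.
case: ltgtP => // <-; rewrite subrr powR0 ?mul0r// oppr_eq0.
by have := hal.2 _ _ sab sab; case: eqVneq => // ->; rewrite ltxx.
Qed.

Lemma weakly_singular_frac_kernel : weakly_singular a b frac_kernel.
Proof.
have cS : compact (`[a, b] `*` `[a, b] : set (R * R)).
  by apply: compact_setX; exact: segment_compact.
have cV : continuous (fun p => (1 - al' p)^-1).
  move=> p; apply: cvgV; first by have := al'01 p; lra.
  by apply: cvgB; [exact: cvg_cst|exact: continuous_al'].
have [N N0 HN] := compact_continuous_ubound cS cV.
have [G G0 HG] := compact_continuous_ubound cS continuous_invGamma.
(* [N] bounds [1 / (1 - al)] on the compact square, so [al <= 1 - 1 / N <= A < 1] there. As before,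
   [D] pays for replacing the variable exponent by [A], and [G] bounds the Gamma factor. *)
pose A := Num.max 0 (1 - N^-1); pose D := 1 + `|b - a|.
have D1 : 1 <= D by rewrite lerDl.
have A01 : 0 <= A < 1.
  by rewrite /A le_max lexx/= gt_max ltr01/= gtrBl invr_gt0.
split.
- exists (D * G), A; split=> //.
    by rewrite mulr_ge0 ?(ltW G0)// (le_trans ler01).
  move=> t s tab sab; rewrite /frac_kernel; case: ltP => st; last first.
    by rewrite normr0 !mulr_ge0 ?powR_ge0 ?(ltW G0)// (le_trans ler01).
  have ts0 : 0 < t - s by rewrite subr_gt0.
  have alA : al' (t, s) <= A.
    rewrite le_max; apply/orP; right.
    have := HN (t, s) (conj tab sab).
    have q0 : 0 < 1 - al' (t, s) by have := al'01 (t, s); lra.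
    by rewrite invf_ple ?posrE//; lra.
  rewrite gtr0_norm; last by rewrite mulr_gt0 ?powR_gt0// invr_gt0.
  rewrite mulrAC ler_pM ?powR_ge0 ?invr_ge0 ?(ltW (Gamma_al'_gt0 _))//; last exact: HG (t, s) (conj tab sab).
  rewrite gtr0_norm// (_ : - al' (t, s) = (A - al' (t, s)) - A); last by ring.
  rewrite powRD ?(gt_eqF ts0) ?implybT// ler_wpM2r ?powR_ge0//.
  apply: (@le_trans _ _ (D `^ (A - al' (t, s)))).
    have tsD : t - s <= D.
      move: tab sab; rewrite !in_itv/= /D => /andP[ta tb] /andP[sa sb].
      by have := ler_norm (b - a); lra.
    have D0 : 0 <= D by exact: le_trans D1.
    by apply: ge0_ler_powR => //; rewrite ?nnegrE ?subr_ge0// ltW.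
  by apply: ler1_powR => //; have := al'01 (t, s); move: A01; lra.
- by move=> t; rewrite /frac_kernel ltxx.
- have cB : continuous (fun p : R * R => p.1 - p.2).
    by move=> p; apply: cvgB; [exact: cvg_fst|exact: cvg_snd].
  move=> t s; rewrite neq_lt => /orP[ts|st].
    have near0 : \forall p \near (t, s), frac_kernel p.1 p.2 = 0.
      have := @cvgr_lt _ _ _ _ _ _ (cB (t, s)) 0.
      rewrite subr_lt0 => /(_ _ ts); apply: filterS => p /=.
      by rewrite /frac_kernel subr_lt0 => /ltW; case: ltgtP.
    apply/cvgrPdist_lt => e e0; apply: filterS near0 => p /= ->.
    by rewrite /frac_kernel [s < t]ltNge (ltW ts)/= subrr normr0.
  have st0 : 0 < t - s by rewrite subr_gt0.
  (* Base and exponent both vary with the point, so continuity is read off the exponential form of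
     the power, valid in a neighbourhood below the diagonal. *)
  have nearE : \forall p \near (t, s), frac_kernel p.1 p.2 =
      expR (- al' p * ln (p.1 - p.2)) * invGamma p.
    have := @cvgr_gt _ _ _ _ _ _ (cB (t, s)) 0.
    move=> /(_ _ st0); apply: filterS => -[p1 p2] /=.
    by rewrite /frac_kernel subr_gt0 => p21; rewrite p21 /powR gt_eqF ?subr_gt0.
  have cE : {for (t, s), continuous (fun p => expR (- al' p * ln (p.1 - p.2)) * invGamma p)}.
    apply: cvgM; last exact: continuous_invGamma.
    apply: (@continuous_comp _ _ _ (fun p => - al' p * ln (p.1 - p.2)) expR).
      apply: cvgM; first by apply: cvgN; exact: continuous_al'.
      exact: (continuous_comp (cB (t, s)) (continuous_ln st0)).
    exact: continuous_expR.
  apply/cvgrPdist_lt => e e0; have E0 := nbhs_singleton nearE.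
  have /cvgrPdist_lt /(_ e e0) := cE; rewrite E0.
  by apply: filterS2 nearE => p /= ->.
Qed.

End Order.
End FractionalKernels.

(** * The fractional operators as integral operators over a fixed interval *)

Section CombinedCaputo.
Context {R : realType}.
Notation mu := (@lebesgue_measure R).
Implicit Types (a b c d p q s t T : R) (x y z w : R -> R) (f g : R -> R).

(** For a state of class C^1 on [[a, b]], [derive1] is controlled on the open interval only; the
    null set of endpoints affects neither measurability nor the integral. *)
Lemma integrable_itv_oo_eq c d f g : {in `]c, d[, f =1 g} ->
  mu.-integrable `[c, d] (EFin \o g) ->
  mu.-integrable `[c, d] (EFin \o f) /\
  \int[mu]_(t in `[c, d]) f t = \int[mu]_(t in `[c, d]) g t.
Proof.
move=> fg intg.
have /integrableP[/measurable_EFinP mg _] := intg.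
have mgo : measurable_fun `]c, d[ g.
  by apply: measurable_funS mg => //; exact: subset_itv_oo_cc.
have mfo : measurable_fun `]c, d[ f.
  apply: (eq_measurable_fun g) => // t; rewrite inE => tcd.
  by rewrite fg.
split; last first.
  by rewrite /Rintegral; congr fine; exact: eq_integral_itv_bounded.
apply/integrableP; split.
  by apply/measurable_EFinP; exact: (measurable_fun_itv_cc mfo).
have /integrableP[_] := intg; congr (_ < _)%E.
apply: (@eq_integral_itv_bounded _ c d (fun t => `|f t|) (fun t => `|g t|)).
- exact: measurableT_comp.
- exact: measurableT_comp.
- by move=> t tcd /=; rewrite fg.
Qed.

(** Moving limits of integration are thereby absorbed into kernels that vanish on one side of the
    diagonal. *)
Lemma Rintegral_itv_widen c d p q f g : p <= c -> d <= q ->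
  (forall s, s \in `[p, q] -> g s = if s \in `[c, d] then f s else 0) ->
  \int[mu]_(s in `[c, d]) f s = \int[mu]_(s in `[p, q]) g s.
Proof.
move=> pc dq gE; rewrite Rintegral_mkcond [RHS]Rintegral_mkcond.
apply: eq_Rintegral => s _; rewrite !patchE !mem_setE.
case: ifPn => scd.
  have spq : s \in `[p, q].
    by move: scd; rewrite !in_itv/= => /andP[/(le_trans pc)-> /le_trans->].
  by rewrite spq gE// scd.
by case: ifPn => // spq; rewrite gE// (negbTE scd).
Qed.

Lemma integral_op_lincomb a b k1 k2 K1 K2 c d z t :
  weakly_singular a b K1 -> weakly_singular a b K2 -> continuous z ->
  a <= c -> d <= b -> t \in `[a, b] ->
  integral_op (fun t s => k1 * K1 t s + k2 * K2 t s) c d z t =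
    k1 * integral_op K1 c d z t + k2 * integral_op K2 c d z t.
Proof.
move=> w1 w2 cz ac db tab.
have i1 := weakly_singular_integrable w1 cz tab ac db.
have i2 := weakly_singular_integrable w2 cz tab ac db.
rewrite /integral_op -(RintegralZl k1 _ i1)// -(RintegralZl k2 _ i2)// -RintegralD//.
- by apply: eq_Rintegral => s _; ring.
- exact: (integrableZl _ k1 i1).
- exact: (integrableZl _ k2 i2).
Qed.

Section Operators.
Variables (a b : R) (ab : a < b).

Section OneOrder.
Variables (al : R -> R -> R) (hal : fractional_order a b al).
Let KA := frac_kernel a b al.

Lemma left_integralE p q y z t : a <= p -> q <= b -> t \in `[a, q] ->
  (forall s, s \in `[p, q] -> y s = z s) ->
  left_integral al p y t = integral_op KA p q z t.
Proof.
move=> ap qb; rewrite in_itv/= => /andP[at_ tq] yz.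
apply: Rintegral_itv_widen => // s spq.
have tab : t \in `[a, b] by rewrite in_itv/= at_ (le_trans tq).
have sab : s \in `[a, b].
  by move: spq; rewrite !in_itv/= => /andP[/(le_trans ap)-> /le_trans->].
rewrite /KA frac_kernelE// yz//; move: spq; rewrite !in_itv/= => /andP[-> _] /=.
by case: ifP => //; rewrite mul0r.
Qed.

Lemma right_integralE p q y z t : a <= p -> q <= b -> t \in `[p, b] ->
  continuous z -> (forall s, s \in `[p, q] -> y s = z s) ->
  right_integral al q y t = - integral_op (fun t s => KA s t) p q z t.
Proof.
move=> ap qb; rewrite in_itv/= => /andP[pt tb] cz yz.
rewrite -mulN1r /integral_op.
have -> : right_integral al q y t = \int[mu]_(s in `[p, q]) (-1 * (KA s t * z s)).
  apply: Rintegral_itv_widen => // s spq.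
  have tab : t \in `[a, b] by rewrite in_itv/= tb (le_trans ap).
  have sab : s \in `[a, b].
    by move: spq; rewrite !in_itv/= => /andP[/(le_trans ap)-> /le_trans->].
  rewrite /KA frac_kernelE// yz//; move: spq; rewrite !in_itv/= => /andP[_ ->] /=.
  rewrite andbT; case: ifP => _; last by rewrite mul0r mulr0.
  by rewrite /right_kernel /left_kernel; ring.
have wK := weakly_singular_tr (weakly_singular_frac_kernel ab hal).
rewrite RintegralZl//; apply: (weakly_singular_integrable wK) => //.
by rewrite in_itv/= tb (le_trans ap).
Qed.

End OneOrder.

Variables (al be : R -> R -> R) (gam : R * R).
Hypotheses (hal : fractional_order a b al) (hbe : fractional_order a b be).

(* The combined Caputo derivative is [x |-> \int_a^b Caputo_kernel t s * x'(s) ds],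
   and the dual derivative comes from the transposed kernel with opposite sign. *)
Definition Caputo_kernel t s : R :=
  gam.1 * frac_kernel a b al t s + (- gam.2) * frac_kernel a b be s t.

Lemma weakly_singular_Caputo_kernel : weakly_singular a b Caputo_kernel.
Proof.
apply: weakly_singular_lincomb; first exact: weakly_singular_frac_kernel.
exact: (weakly_singular_tr (weakly_singular_frac_kernel ab hbe)).
Qed.

Let wA := weakly_singular_frac_kernel ab hal.
Let wB := weakly_singular_tr (weakly_singular_frac_kernel ab hbe).

Lemma integral_op_Caputo_kernel c d z t : continuous z -> a <= c -> d <= b ->
  t \in `[a, b] -> integral_op Caputo_kernel c d z t =
    gam.1 * integral_op (frac_kernel a b al) c d z t -
    gam.2 * integral_op (fun t s => frac_kernel a b be s t) c d z t.
Proof.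
by move=> cz ac db tab; rewrite -mulNr; exact: (integral_op_lincomb _ _ wA wB).
Qed.

Lemma integral_op_Caputo_kernel_tr c d z t : continuous z -> a <= c -> d <= b ->
  t \in `[a, b] -> integral_op (fun t s => Caputo_kernel s t) c d z t =
    gam.1 * integral_op (fun t s => frac_kernel a b al s t) c d z t -
    gam.2 * integral_op (frac_kernel a b be) c d z t.
Proof.
move=> cz ac db tab; rewrite -mulNr.
exact: (integral_op_lincomb _ _ (weakly_singular_tr wA) (weakly_singular_tr wB)).
Qed.

(** Only the derivatives are compared, so the same lemma perturbs a given state and, with [x] the
    zero function, computes the Caputo derivative of a primitive of [w]. *)
Lemma combined_Caputo_perturb x z w t : continuous w -> t \in `[a, b] ->
  {in `]a, b[, forall s, derive1 z s = derive1 x s + w s} ->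
  combined_Caputo_exists a b al be x t ->
  combined_Caputo_exists a b al be z t /\
  combined_Caputo a b gam al be z t =
    combined_Caputo a b gam al be x t + integral_op Caputo_kernel a b w t.
Proof.
move=> cw tab zE [ix1 ix2].
move: (tab); rewrite in_itv/= => /andP[at_ tb].
have iA := weakly_singular_integrable wA cw tab (lexx a) tb.
have iB := weakly_singular_integrable wB cw tab at_ (lexx b).
have sab1 s : s \in `[a, t] -> s \in `[a, b].
  by rewrite !in_itv/= => /andP[-> /le_trans->].
have sab2 s : s \in `[t, b] -> s \in `[a, b].
  by rewrite !in_itv/= => /andP[/(le_trans at_)-> ->].
have [iz1 z1] : mu.-integrable `[a, t] (EFin \o (fun s => left_kernel al t s * derive1 z s)) /\
    \int[mu]_(s in `[a, t]) (left_kernel al t s * derive1 z s) =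
    \int[mu]_(s in `[a, t]) (left_kernel al t s * derive1 x s + frac_kernel a b al t s * w s).
  apply: integrable_itv_oo_eq; last by have := integrableD _ ix1 iA; exact.
  move=> s; rewrite in_itv/= => /andP[as_ st].
  have sab : s \in `[a, b] by apply: sab1; rewrite in_itv/= !ltW.
  rewrite frac_kernelE// (ltW st) zE ?mulrDr//.
  by rewrite in_itv/= as_ (lt_le_trans st).
have [iz2 z2] : mu.-integrable `[t, b] (EFin \o (fun s => right_kernel be t s * derive1 z s)) /\
    \int[mu]_(s in `[t, b]) (right_kernel be t s * derive1 z s) =
    \int[mu]_(s in `[t, b]) (right_kernel be t s * derive1 x s + (-1) * (frac_kernel a b be s t * w s)).
  apply: integrable_itv_oo_eq.
    move=> s; rewrite in_itv/= => /andP[ts sb].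
    have sab : s \in `[a, b] by apply: sab2; rewrite in_itv/= !ltW.
    rewrite frac_kernelE// (ltW ts) zE ?mulrDr; last first.
      by rewrite in_itv/= sb (le_lt_trans at_).
    by rewrite /right_kernel /left_kernel; ring.
  by have := integrableD _ ix2 (integrableZl _ (-1) iB); exact.
split; first by split.
rewrite /combined_Caputo /left_Caputo /right_Caputo.
rewrite integral_op_Caputo_kernel//.
have <- : \int[mu]_(s in `[a, t]) (frac_kernel a b al t s * w s) =
    integral_op (frac_kernel a b al) a b w t.
  apply: Rintegral_itv_widen => // s sab; rewrite frac_kernelE//.
  by move: sab; rewrite !in_itv/= => /andP[-> _]/=; case: ifP => //; rewrite mul0r.
have <- : \int[mu]_(s in `[t, b]) (frac_kernel a b be s t * w s) =
    integral_op (fun t s => frac_kernel a b be s t) a b w t.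
  apply: Rintegral_itv_widen => // s sab; rewrite frac_kernelE//.
  by move: sab; rewrite !in_itv/= => /andP[_ ->]; rewrite andbT; case: ifP => //; rewrite mul0r.
move: z1 z2 iA iB {iz1 iz2}.
move: (frac_kernel a b al) (frac_kernel a b be) => KA KB z1 z2 iA iB.
rewrite {1}/left_integral {1}/right_integral z1 z2.
rewrite (RintegralD _ ix1 iA)// (RintegralD _ ix2 (integrableZl _ (-1) iB))//.
rewrite (RintegralZl (-1) _ iB)//.
rewrite -/(left_integral al a (derive1 x) t) -/(right_integral be b (derive1 x) t).
ring.
Qed.

End Operators.
End CombinedCaputo.

(** * Derivatives relative to a set, primitives, mean values *)

Section DerivativesWithin.
Context {R : realType}.
Notation mu := (@lebesgue_measure R).
Implicit Types (a b c t l : R) (A B : set R) (f g w : R -> R).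

Lemma is_derivative_within_sub A B f t l : A `<=` B ->
  is_derivative_within B f t l -> is_derivative_within A f t l.
Proof.
move=> AB H P lP.
have HP : t^' [set s | B s -> P ((f s - f t) / (s - t))] by exact: H lP.
suff : t^' [set s | A s -> P ((f s - f t) / (s - t))] by [].
by apply: filterS HP => s sP /AB.
Qed.

Lemma is_derivative_within_eq A f g t l : A t -> (forall s, A s -> f s = g s) ->
  is_derivative_within A f t l -> is_derivative_within A g t l.
Proof.
move=> At fg; apply: cvg_trans; apply: near_eq_cvg.
rewrite near_withinE; apply: nearW => s As.
by rewrite !fg.
Qed.

Lemma is_derivative_within_lincomb A f g t l m k k' :
  is_derivative_within A f t l -> is_derivative_within A g t m ->
  is_derivative_within A (fun s => k * f s + k' * g s) t (k * l + k' * m).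
Proof.
move=> fl gm.
have H : k * ((f s - f t) / (s - t)) + k' * ((g s - g t) / (s - t))
    @[s --> within A t^'] --> k * l + k' * m.
  by apply: cvgD; apply: cvgM => //; exact: cvg_cst.
apply: cvg_trans H; apply: near_eq_cvg; apply: nearW => s; ring.
Qed.

Lemma derivable_is_derivative_within A f t :
  derivable f t 1 -> is_derivative_within A f t (derive1 f t).
Proof.
move=> df; apply: cvg_within_filter; apply/cvgrPdist_lt => e e0.
have : (h^-1 *: (f (h + t) - f t)) @[h --> 0^'] --> derive1 f t.
  have := df; rewrite /derivable derive1E /derive.
  rewrite (_ : (fun h : R => _) = (fun h => h^-1 *: (f (h + t) - f t))).
    by [].
  by apply/funext => h /=; rewrite /GRing.scale/= mulr1.
move=> /cvgrPdist_lt /(_ e e0) [d /= d0 dP].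
exists d => //= s; rewrite /ball/= => std st.
have := dP (s - t); rewrite /ball/= sub0r normrN distrC => /(_ std).
by rewrite subr_eq0 subrK mulrC; apply.
Qed.

Lemma is_derivative_within_itv_unique a b f t l m : a < b -> t \in `[a, b] ->
  is_derivative_within `[a, b] f t l -> is_derivative_within `[a, b] f t m ->
  l = m.
Proof.
move=> ab; rewrite in_itv/= => /andP[at_ tb] fl fm.
suff FF : ProperFilter (within `[a, b] t^').
  exact: (cvg_unique _ fl fm).
apply: Build_ProperFilter_ex => P [d /= d0 dP].
(* As [a < b], the interval has points other than [t] arbitrarily near it, so the filter is proper
   and limits are unique. The point is taken [d / 2] to the right, or to the left when [t = b], and
   stopped at the endpoint. *)
have [s [sab std st]] : exists s, [/\ s \in `[a, b], `|t - s| < d & s != t].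
  have [tb'|bt] := ltP t b.
    exists (Num.min b (t + d / 2)).
    have [h|h] := leP b (t + d / 2); split; rewrite ?in_itv/= ?ltr_norml; try lra;
      by rewrite gt_eqF//; lra.
  exists (Num.max a (t - d / 2)).
  have [h|h] := leP a (t - d / 2); split; rewrite ?in_itv/= ?ltr_norml; try lra;
    by rewrite lt_eqF//; lra.
by exists s; apply: dP.
Qed.

(** Integrating from [a - 1] and then subtracting the value at [a] makes [a] an interior point, so
    that [W] has a two-sided derivative at [a] as well. *)
Lemma primitive_exists a w : continuous w ->
  exists W : R -> R, [/\ W a = 0,
    forall t, a - 1 < t -> derivable W t 1 /\ derive1 W t = w t &
    forall s t, a <= s -> s <= t -> W t = W s + \int[mu]_(x in `[s, t]) w x].
Proof.
move=> cw; pose V t := \int[mu]_(x in `[a - 1, t]) w x.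
exists (fun t => V t - V a); split; first by rewrite subrr.
- move=> t at_.
  have tt : t < t + 1 by rewrite ltrDl.
  have [dV V'] := continuous_FTC1_closed (f := w) tt
    (continuous_integrable_itv _ _ cw) at_ (cw t).
  have idV : is_derive t 1 (V : R -> R) (w t).
    by rewrite -V' derive1E; exact: derivableP.
  have [dW eW] : is_derive t 1 (V - cst (V a) : R -> R) (w t - 0).
    by apply: is_deriveB.
  by split; [exact: dW|rewrite derive1E eW subr0].
- move=> s t as_ st; rewrite /V (@Rintegral_itv_cat _ _ _ t s)//.
  + ring.
  + exact: continuous_integrable_itv.
  + by rewrite (le_trans _ as_)// gerBl.
Qed.

Lemma MVT_dist f u p : (forall t, derivable f t 1) ->
  exists2 c, `|c| <= `|p| & f (u + p) - f u = derive1 f (u + c) * p.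
Proof.
move=> df; have cf : continuous f.
  by move=> t; have := df t; rewrite derivable1_diffP; exact: differentiable_continuous.
have idf t : is_derive t 1 f (derive1 f t) by rewrite derive1E; exact: derivableP.
have [p0|p0] := leP 0 p.
  have := @MVT_segment _ f (derive1 f) u (u + p); rewrite lerDl => /(_ p0 (fun t _ => idf t)).
  move=> /(_ (continuous_subspaceT cf))[c].
  rewrite in_itv/= => /andP[uc cp] ->; exists (c - u).
    by rewrite ger0_norm ?ger0_norm//; lra.
  by congr (derive1 f _ * _); ring.
have := @MVT_segment _ f (derive1 f) (u + p) u; rewrite gerDl => /(_ (ltW p0) (fun t _ => idf t)).
move=> /(_ (continuous_subspaceT cf))[c].
rewrite in_itv/= => /andP[uc cp] E; exists (c - u).
  by rewrite ler0_norm ?ltr0_norm//; lra.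
rewrite (_ : u + (c - u) = c); last by ring.
by rewrite -opprB E; ring.
Qed.

End DerivativesWithin.

(** * Uniform first-order expansion of an integral functional *)

Section FirstVariation.
Context {R : realType}.
Notation mu := (@lebesgue_measure R).
Implicit Types (a b c d t T : R) (u v w y : R -> R) (z : R -> R -> R -> R).

(** The derivative in the first argument is left out because the time [T] is not varied. The
    conditions hold for all [t] since clamped integrands are defined on the whole line. *)
Definition C1_state z : Prop :=
  [/\ forall t (x s : R), derivable (fun x' => z t x' s) x 1 /\
        derivable (fun s' => z t x s') s 1,
      continuous (fun p : R * R * R => z p.1.1 p.1.2 p.2),
      continuous (fun p : R * R * R => partial2 z p.1.1 p.1.2 p.2) &
      continuous (fun p : R * R * R => partial3 z p.1.1 p.1.2 p.2)].

Lemma C1_strip3_clamp a b z : a <= b -> C1_strip3 a b z ->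
  C1_state (fun t => z (clamp a b t)).
Proof.
move=> ab [z1 [dz [cz _ cz2 cz3]]].
pose r (p : R * R * R) : R * R * R := (clamp a b p.1.1, p.1.2, p.2).
have rS p : [set p : R * R * R | p.1.1 \in `[a, b]] (r p) by exact: clamp_in.
have cr : continuous r.
  have c1 : continuous (fun p : R * R * R => clamp a b p.1.1).
    move=> p; apply: (@continuous_comp _ _ _ (fun p : R * R * R => p.1.1)).
      by apply: (@continuous_comp _ _ _ fst fst); exact: cvg_fst.
    exact: continuous_clamp.
  have c2 : continuous (fun p : R * R * R => p.1.2).
    by move=> p; apply: (@continuous_comp _ _ _ fst snd); [exact: cvg_fst|exact: cvg_snd].
  have c12 : continuous (fun p : R * R * R => (clamp a b p.1.1, p.1.2)).
    by move=> p; exact: (cvg_pair (c1 p) (c2 p)).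
  by move=> p; exact: (cvg_pair (c12 p) cvg_snd).
split.
- by move=> t x s; have [_ ? ?] := dz _ x s (clamp_in t ab).
- exact: (within_continuous_comp cz cr rS).
- exact: (within_continuous_comp cz2 cr rS).
- exact: (within_continuous_comp cz3 cr rS).
Qed.

Lemma continuous_comp3 (S : topologicalType) (f : R -> R -> R -> R) (r s q : S -> R) :
  continuous (fun p : R * R * R => f p.1.1 p.1.2 p.2) ->
  continuous r -> continuous s -> continuous q ->
  continuous (fun x => f (r x) (s x) (q x)).
Proof.
move=> cf cr cs cq.
have crs : continuous (fun x => (r x, s x)) by move=> x; exact: (cvg_pair (cr x) (cs x)).
exact: (continuous_comp_pair cf crs cq).
Qed.

Section AtPoint.
Variables (z : R -> R -> R -> R) (y v : R -> R).
Hypotheses (hz : C1_state z) (cy : continuous y) (cv : continuous v).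

Let z2 t := partial2 z t (y t) (v t).
Let z3 t := partial3 z t (y t) (v t).

Let near_uniform a b (f : R -> R -> R -> R) e :
  continuous (fun p : R * R * R => f p.1.1 p.1.2 p.2) -> 0 < e ->
  exists2 d, 0 < d & forall p q t, `|p| < d -> `|q| < d -> t \in `[a, b] ->
    `|f t (y t + p) (v t + q) - f t (y t) (v t)| < e.
Proof.
move=> cf e0.
have cg : continuous (fun x : (R * R) * R =>
    f x.2 (y x.2 + x.1.1) (v x.2 + x.1.2)).
  apply: continuous_comp3 => // x; first exact: cvg_snd.
    apply: cvgD; last by apply: (@continuous_comp _ _ _ fst fst); exact: cvg_fst.
    by apply: (@continuous_comp _ _ _ snd y); [exact: cvg_snd|exact: cy].
  apply: cvgD; last by apply: (@continuous_comp _ _ _ fst snd); [exact: cvg_fst|exact: cvg_snd].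
  by apply: (@continuous_comp _ _ _ snd v); [exact: cvg_snd|exact: cv].
have /nbhs_ballP[d /= d0 H] :=
  compact_continuous_near (0, 0) (@segment_compact _ a b) cg e0.
exists d => // p q t pd qd tab.
have /H : ball ((0, 0) : R * R) d (p, q) by split; rewrite /ball/= sub0r normrN.
by move=> /(_ t tab) /=; rewrite !addr0.
Qed.

(** The mean value theorem is applied to one argument at a time. The intermediate points stay within
    [|p|] and [|q|] of the reference curve, where compactness makes the partial derivatives
    uniformly close to their values on it. *)
Lemma first_variation_pointwise a b e : 0 < e ->
  exists2 d, 0 < d & forall p q t, `|p| <= d -> `|q| <= d -> t \in `[a, b] ->
    `|z t (y t + p) (v t + q) - z t (y t) (v t) - (z2 t * p + z3 t * q)| <=
      e * (`|p| + `|q|).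
Proof.
move=> e0; have [dz _ cz2 cz3] := hz.
have [d2 d20 H2] := near_uniform a b cz2 e0.
have [d3 d30 H3] := near_uniform a b cz3 e0.
have m0 : 0 < Num.min d2 d3 by rewrite lt_min d20.
exists (Num.min d2 d3 / 2) => [|p q t pd qd tab]; first by rewrite divr_gt0.
have [pd2 pd3] : `|p| < d2 /\ `|p| < d3.
  by apply/andP; rewrite -lt_min; lra.
have [qd2 qd3] : `|q| < d2 /\ `|q| < d3.
  by apply/andP; rewrite -lt_min; lra.
have [c cp Ec] := MVT_dist (y t) p (fun p' => (dz t p' (v t + q)).1).
have [c' cq Ec'] := MVT_dist (v t) q (fun q' => (dz t (y t) q').2).
have B2 := H2 c q t (le_lt_trans cp pd2) qd2 tab.
(* The second increment is taken with the state already back at [y t], hence the offset 0. *)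
have B3 := H3 0 c' t ltac:(by rewrite normr0) (le_lt_trans cq qd3) tab.
rewrite addr0 in B3.
rewrite (_ : _ - _ = (partial2 z t (y t + c) (v t + q) - z2 t) * p +
    (partial3 z t (y t) (v t + c') - z3 t) * q); last first.
  have Ep : partial2 z t (y t + c) (v t + q) * p = _ := esym Ec.
  have Eq : partial3 z t (y t) (v t + c') * q = _ := esym Ec'.
  rewrite !mulrBl Ep Eq; ring.
apply: le_trans (ler_normD _ _) _; rewrite !normrM mulrDr.
apply: lerD; apply: ler_wpM2r; first exact: normr_ge0.
- exact: ltW B2.
- exact: normr_ge0.
- exact: ltW B3.
Qed.

(** The threshold [d] depends on the directions only through their bound [rho], so a whole family of
    directions can be handled with a single [d]. *)
Lemma first_variation a T e : a <= T -> 0 < e ->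
  exists2 d, 0 < d & forall rho u w, rho <= d -> continuous u -> continuous w ->
    (forall t, t \in `[a, T] -> `|u t| <= rho /\ `|w t| <= rho) ->
    `|\int[mu]_(t in `[a, T]) z t (y t + u t) (v t + w t) -
      \int[mu]_(t in `[a, T]) z t (y t) (v t) -
      \int[mu]_(t in `[a, T]) (z2 t * u t + z3 t * w t)| <= e * rho.
Proof.
move=> aT e0; have [dz cz cz2 cz3] := hz.
(* Integrating the pointwise error gives at most [e' * (rho + rho) * (T - a)]; the summand 1 keeps
   the denominator positive when [T = a]. *)
pose e' := e / (2 * (T - a) + 1).
have Ta0 : 0 < 2 * (T - a) + 1 by lra.
have e'0 : 0 < e' by rewrite divr_gt0.
have [d d0 Hd] := first_variation_pointwise a T e'0.
exists d => // rho u w rhod cu cw uw.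
have id_cont : continuous (fun t : R => t) by move=> t; exact: cvg_id.
have c1 : continuous (fun t => z t (y t + u t) (v t + w t)).
  by apply: continuous_comp3 => // t; apply: cvgD; [exact: cy|exact: cu|exact: cv|exact: cw].
have c2 : continuous (fun t => z t (y t) (v t)) by exact: continuous_comp3.
have c3 : continuous (fun t => z2 t * u t + z3 t * w t).
  move=> t; apply: cvgD; apply: cvgM; [|exact: cu| |exact: cw].
    by apply: (@continuous_comp3 _ (partial2 z) id y v).
  by apply: (@continuous_comp3 _ (partial3 z) id y v).
have i1 := continuous_integrable_itv a T c1.
have i2 := continuous_integrable_itv a T c2.
have i3 := continuous_integrable_itv a T c3.
have c12 : continuous (fun t => z t (y t + u t) (v t + w t) - z t (y t) (v t)).
  by move=> t; apply: cvgB; [exact: c1|exact: c2].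
have c123 : continuous (fun t => z t (y t + u t) (v t + w t) - z t (y t) (v t) -
    (z2 t * u t + z3 t * w t)).
  by move=> t; apply: cvgB; [exact: c12|exact: c3].
rewrite -(RintegralB _ i1 i2)// -(RintegralB _ (continuous_integrable_itv a T c12) i3)//.
have [rho0|rho0] := leP 0 rho; last first.
  have := uw a; rewrite in_itv/= lexx aT => /(_ isT)[/(le_trans (normr_ge0 _))].
  by rewrite leNgt rho0.
apply: (@le_trans _ _ (e' * (rho + rho) * (T - a))).
  apply: ler_norm_Rintegral_itv => //; first exact: continuous_integrable_itv.
  move=> t tT; have [ut wt] := uw t tT.
  apply: (le_trans (Hd _ _ _ (le_trans ut rhod) (le_trans wt rhod) tT)).
  by rewrite ler_wpM2l ?(ltW e'0)// lerD.
rewrite /e' (_ : e / _ * (rho + rho) * (T - a) = e * rho * (2 * (T - a) / (2 * (T - a) + 1))).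
  rewrite ler_piMr ?mulr_ge0 ?(ltW e0)// ler_pdivrMr// mul1r; lra.
by field; rewrite gt_eqF.
Qed.

End AtPoint.
End FirstVariation.

(** * Descent along a constraint by the intermediate value theorem *)

Section Multipliers.
Context {R : realType}.
Notation mu := (@lebesgue_measure R).
Implicit Types (a b c d t T : R) (u v w y : R -> R) (z : R -> R -> R -> R).

Lemma sum4_bounds (p q r s : R) : 0 <= p -> 0 <= q -> 0 <= r -> 0 <= s ->
  [/\ 1 <= 1 + p + q + r + s, p + q <= 1 + p + q + r + s &
      r + s <= 1 + p + q + r + s].
Proof. by move=> *; split; lra. Qed.

Section Variations.
Variables (a T : R) (aT : a <= T) (y v : R -> R).
Hypotheses (cy : continuous y) (cv : continuous v).

Definition action z u w : R :=
  \int[mu]_(t in `[a, T]) z t (y t + u t) (v t + w t).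

Definition variation z u w : R := \int[mu]_(t in `[a, T])
  (partial2 z t (y t) (v t) * u t + partial3 z t (y t) (v t) * w t).

Lemma continuous_variation_integrand z u w : C1_state z -> continuous u ->
  continuous w -> continuous (fun t =>
    partial2 z t (y t) (v t) * u t + partial3 z t (y t) (v t) * w t).
Proof.
move=> [_ _ c2 c3] cu cw.
have cid : continuous (@id R) by move=> t; exact: cvg_id.
have cz2 := continuous_comp3 c2 cid cy cv.
have cz3 := continuous_comp3 c3 cid cy cv.
by move=> t; apply: cvgD; apply: cvgM; [exact: cz2|exact: cu|exact: cz3|exact: cw].
Qed.

Lemma variation_lincomb z k1 k2 u1 u2 w1 w2 : C1_state z ->
  continuous u1 -> continuous u2 -> continuous w1 -> continuous w2 ->
  variation z (fun t => k1 * u1 t + k2 * u2 t) (fun t => k1 * w1 t + k2 * w2 t) =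
  k1 * variation z u1 w1 + k2 * variation z u2 w2.
Proof.
move=> hz cu1 cu2 cw1 cw2.
have i1 := continuous_integrable_itv a T (continuous_variation_integrand hz cu1 cw1).
have i2 := continuous_integrable_itv a T (continuous_variation_integrand hz cu2 cw2).
rewrite /variation -(RintegralZl k1 _ i1)// -(RintegralZl k2 _ i2)//.
rewrite -(RintegralD _ (integrableZl _ k1 i1) (integrableZl _ k2 i2))//.
by apply: eq_Rintegral => t _; ring.
Qed.

(* Along [(k1, k2) = eps (1, s)] the constraint changes by [eps s + o(eps)], so
   the intermediate value theorem restores it with a small [s], while the cost
   still decreases at rate [variation zL u1 w1 < 0]. *)
Lemma constrained_descent zL zg u1 w1 u2 w2 delta :
  C1_state zL -> C1_state zg ->
  continuous u1 -> continuous w1 -> continuous u2 -> continuous w2 ->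
  variation zg u1 w1 = 0 -> variation zg u2 w2 = 1 -> variation zL u1 w1 < 0 ->
  0 < delta -> exists k1 k2, [/\ `|k1| <= delta, `|k2| <= delta,
    action zg (fun t => k1 * u1 t + k2 * u2 t) (fun t => k1 * w1 t + k2 * w2 t) =
      action zg (cst 0) (cst 0) &
    action zL (fun t => k1 * u1 t + k2 * u2 t) (fun t => k1 * w1 t + k2 * w2 t) <
      action zL (cst 0) (cst 0)].
Proof.
move=> hL hg cu1 cw1 cu2 cw2 g1 g2 L1 delta0.
have [B B1 HB] : exists2 B, 1 <= B & forall t, t \in `[a, T] ->
    [/\ `|u1 t| + `|u2 t| <= B & `|w1 t| + `|w2 t| <= B].
  have [p p0 Hu1] := continuous_bounded_itv a T cu1.
  have [q q0 Hu2] := continuous_bounded_itv a T cu2.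
  have [r r0 Hw1] := continuous_bounded_itv a T cw1.
  have [s s0 Hw2] := continuous_bounded_itv a T cw2.
  have [b1 b2 b3] := sum4_bounds p0 q0 r0 s0.
  exists (1 + p + q + r + s) => // t tT; split.
    by apply: le_trans b2; apply: lerD; [exact: Hu1|exact: Hu2].
  by apply: le_trans b3; apply: lerD; [exact: Hw1|exact: Hw2].
have B0 : 0 < B by exact: lt_le_trans B1.
set L := variation zL u1 w1 in L1; set L' := variation zL u2 w2.
(* [kap] is the range allowed to the correction [s]: within it, the second direction gives back at
   most a quarter of the descent [- L]. *)
have [kap [kap0 kap1 kapL]] : exists kap, [/\ 0 < kap, kap <= 1 & kap * `|L'| <= - L / 4].
  exists (Num.min 1 (- L / (4 * (`|L'| + 1)))).
  have L'1 : 0 < `|L'| + 1 by rewrite ltr_wpDl.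
  have q0 : 0 < - L / (4 * (`|L'| + 1)) by rewrite divr_gt0 ?mulr_gt0// oppr_gt0.
  split; first by rewrite lt_min ltr01.
  - by rewrite ge_min lexx.
  - apply: (@le_trans _ _ (- L / (4 * (`|L'| + 1)) * `|L'|)).
      by rewrite ler_wpM2r// ge_min lexx orbT.
    rewrite (_ : _ * `|L'| = - L / 4 * (`|L'| / (`|L'| + 1))); last first.
      by field; rewrite gt_eqF.
    rewrite ler_piMr//; first by rewrite divr_ge0// oppr_ge0 ltW.
    by rewrite ler_pdivrMr// mul1r lerDl.
(* All directions used have size at most [eps * B]. These tolerances turn the remainders into
   [eps * kap / 2] for the constraint and [eps * - L / 4] for the cost. *)
have eg0 : 0 < kap / (2 * B) by rewrite divr_gt0 ?mulr_gt0.
have eL0 : 0 < - L / (4 * B) by rewrite divr_gt0 ?mulr_gt0// oppr_gt0.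
have [dg dg0 Hg] := first_variation hg cy cv aT eg0.
have [dL dL0 HL] := first_variation hL cy cv aT eL0.
have [eps [eps0 epsd epsg epsL]] : exists eps, [/\ 0 < eps, eps <= delta,
    eps * B <= dg & eps * B <= dL].
  exists (Num.min delta (Num.min dg dL / B)).
  have m0 : 0 < Num.min dg dL by rewrite lt_min dg0.
  split; first by rewrite lt_min delta0 divr_gt0.
  - by rewrite ge_min lexx.
  - rewrite -ler_pdivlMr// ge_min; apply/orP; right.
    by rewrite ler_pM2r ?invr_gt0// ge_min lexx.
  - rewrite -ler_pdivlMr// ge_min; apply/orP; right.
    by rewrite ler_pM2r ?invr_gt0// ge_min lexx orbT.
pose u s t := eps * u1 t + (eps * s) * u2 t.
pose w s t := eps * w1 t + (eps * s) * w2 t.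
have lc (f g : R -> R) k k' : continuous f -> continuous g ->
    continuous (fun t => k * f t + k' * g t).
  by move=> cf cg t; apply: cvgD; apply: cvgM; [exact: cvg_cst|exact: cf|exact: cvg_cst|exact: cg].
have small s : `|s| <= kap -> forall t, t \in `[a, T] ->
    `|u s t| <= eps * B /\ `|w s t| <= eps * B.
  move=> sk t tT; have [HBu HBw] := HB t tT.
  have s1 : `|s| <= 1 by exact: le_trans kap1.
  have bound (x x' : R) : `|x| + `|x'| <= B -> `|eps * x + eps * s * x'| <= eps * B.
    move=> xB; rewrite -mulrA -mulrDr normrM (gtr0_norm eps0) ler_wpM2l ?(ltW eps0)//.
    apply: le_trans xB; apply: le_trans (ler_normD _ _) _.
    by rewrite lerD2l normrM ler_piMl.
  by split; exact: bound.
have action0 z : action z (cst 0) (cst 0) = \int[mu]_(t in `[a, T]) z t (y t) (v t).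
  by apply: eq_Rintegral => t _; rewrite !addr0.
have errg s : `|s| <= kap ->
    `|action zg (u s) (w s) - action zg (cst 0) (cst 0) - eps * s| <= eps * kap / 2.
  move=> sk; have := Hg _ _ _ epsg (lc _ _ eps (eps * s) cu1 cu2) (lc _ _ eps (eps * s) cw1 cw2) (small s sk).
  rewrite -/(variation zg (u s) (w s)) variation_lincomb// g1 g2 action0 mulr0 mulr1 add0r.
  by move=> /le_trans; apply; rewrite le_eqVlt; apply/orP; left; apply/eqP; field; rewrite gt_eqF.
have errL s : `|s| <= kap ->
    `|action zL (u s) (w s) - action zL (cst 0) (cst 0) - (eps * L + eps * s * L')| <= eps * - L / 4.
  move=> sk; have := HL _ _ _ epsL (lc _ _ eps (eps * s) cu1 cu2) (lc _ _ eps (eps * s) cw1 cw2) (small s sk).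
  rewrite -/(variation zL (u s) (w s)) variation_lincomb// action0.
  by move=> /le_trans; apply; rewrite le_eqVlt; apply/orP; left; apply/eqP; field; rewrite gt_eqF.
have cG : continuous (fun s => action zg (u s) (w s)).
  have [_ cz _ _] := hg.
  apply: (@continuous_Rintegral_param _ _ (fun s t => zg t (y t + u s t) (v t + w s t))).
  have c2 (f : R -> R) : continuous f -> continuous (fun p : R * R => f p.2).
    by move=> cf p; apply: (@continuous_comp _ _ _ snd f); [exact: cvg_snd|exact: cf].
  have cc (f g h : R -> R) : continuous f -> continuous g -> continuous h ->
      continuous (fun p : R * R => f p.2 + (eps * g p.2 + eps * p.1 * h p.2)).
    move=> cf cg ch p; apply: cvgD; first exact: (c2 f cf).
    apply: cvgD; first by apply: cvgM; [exact: cvg_cst|exact: (c2 g cg)].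
    apply: cvgM; last exact: (c2 h ch).
    by apply: cvgM; [exact: cvg_cst|exact: cvg_fst].
  apply: (continuous_comp3 cz); [|exact: cc|exact: cc].
  by move=> p; exact: cvg_snd.
have ek0 : 0 < eps * kap by rewrite mulr_gt0.
(* At [s = kap] and [s = - kap] the main term [eps * s] outweighs the remainder [eps * kap / 2], so
   the constraint is overshot on one side and undershot on the other. *)
have [s sk Es] : exists2 s, s \in `[- kap, kap] &
    action zg (u s) (w s) = action zg (cst 0) (cst 0).
  apply: IVT; first by apply: (@le_trans _ _ 0); rewrite ?oppr_le0 ltW.
    exact: continuous_subspaceT.
  have := errg kap; have := errg (- kap).
  rewrite normrN (gtr0_norm kap0) lexx => /(_ isT) + /(_ isT).
  rewrite !ler_norml ge_min le_max => /andP[h1 h2] /andP[h3 h4].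
  by apply/andP; split; apply/orP; [left; clear -ek0 h2|right; clear -ek0 h3]; lra.
have sk' : `|s| <= kap by move: sk; rewrite in_itv/= ler_norml.
exists eps, (eps * s); split=> //.
- by rewrite gtr0_norm.
- rewrite normrM (gtr0_norm eps0) (le_trans _ epsd)// ler_piMr ?(ltW eps0)//.
  exact: le_trans kap1.
(* The correction and the remainder each give back at most [eps * - L / 4], so the cost changes by
   at most [eps * L / 2 < 0]. *)
- have := errL s sk'; rewrite ler_norml => /andP[_ h1].
  have sL' : s * L' <= - L / 4.
    apply: le_trans (ler_norm _) _; rewrite normrM (le_trans _ kapL)//.
    by rewrite ler_wpM2r.
  have h2 : eps * (s * L') <= eps * (- L / 4) by rewrite ler_wpM2l// ltW.
  have h3 : eps * L < 0 by rewrite pmulr_rlt0.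
  rewrite -/(u s) -/(w s); clear -h1 h2 h3; lra.
Qed.

End Variations.
End Multipliers.

(** * The lemma of du Bois-Reymond and the kernel of plain integration *)

Section Auxiliary.
Context {R : realType}.
Notation mu := (@lebesgue_measure R).
Implicit Types (a b c d s t T l : R) (f g u v w y P : R -> R) (K : R -> R -> R).

Lemma is_derivative_within_point c f t l : is_derivative_within `[c, c] f t l.
Proof.
move=> P /nbhs_singleton Pl.
suff : t^' [set s | `[c, c]%classic s -> P ((f s - f t) / (s - t))] by [].
have [<-|tc] := eqVneq t c.
  exists 1 => //= s _ st /=; rewrite in_itv/= => /andP[ts st'].
  by move: st; rewrite eq_le ts st'.
exists `|t - c|; first by rewrite /= normr_gt0 subr_eq0.
move=> s /= tsc st; rewrite in_itv/= -eq_le => /eqP cs.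
by move: tsc; rewrite cs ltxx.
Qed.

Lemma is_derivative_within_interior a b f t l : t \in `]a, b[ ->
  is_derivative_within `[a, b] f t l -> is_derive t 1 f l.
Proof.
move=> tab H.
suff C : h^-1 *: ((f \o shift t) (h *: (1 : R)) - f t) @[h --> 0^'] --> l.
  by split; [apply/cvg_ex; exists l|exact: cvg_lim].
apply/cvgrPdist_lt => e e0.
have /cvgrPdist_lt /(_ e e0) := H.
move=> [d /= d0 dP].
have [d' /= d'0 d'P] := near_in_itvoo tab.
exists (Num.min d d'); first by rewrite /= lt_min d0.
move=> h /=; rewrite sub0r normrN lt_min => /andP[hd hd'] h0.
have hE : h *: (1 : R) + t = h + t by rewrite /GRing.scale/= mulr1.
rewrite hE /GRing.scale/= mulrC.
have := dP (h + t); rewrite /= opprD addrCA subrr addr0 normrN => /(_ hd).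
rewrite addrK => /(_ _ _); apply.
  by rewrite -subr_eq0 addrK.
by apply: subset_itv_oo_cc; apply: d'P; rewrite /= opprD addrCA subrr addr0 normrN.
Qed.

Lemma C1_on_continuous a b f : C1_on a b f -> {within `[a, b], continuous f}.
Proof.
move=> [df [dfE _]]; apply/subspace_continuousP => t tab.
apply/cvgrPdist_lt => e e0.
have H : (f s - f t) / (s - t) * (s - t) @[s --> within `[a, b] t^'] --> df t * 0.
  apply: cvgM; first exact: dfE.
  have cB : {for t, continuous (fun s : R => s - t)}.
    by apply: cvgB; [exact: cvg_id|exact: cvg_cst].
  rewrite /prop_for /continuous_at subrr in cB.
  exact: (cvg_within_filter _ (cvg_within_filter _ cB)).
move: H; rewrite mulr0 => /cvgrPdist_lt /(_ e e0) [d /= d0 dP].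
exists d => //= s /= std sab.
have [->|st] := eqVneq s t; first by rewrite subrr normr0.
have := dP s std st sab.
by rewrite sub0r normrN divfK ?subr_eq0// distrC.
Qed.

Lemma continuous_itv_cc_eq0 p q f : continuous f -> p < q ->
  {in `]p, q[, forall t, f t = 0} -> {in `[p, q], forall t, f t = 0}.
Proof.
move=> cf pq f0 t tpq; apply/eqP; apply: contraT => ft0.
have n0 : 0 < `|f t| by rewrite normr_gt0.
have /cvgrPdist_lt /(_ _ n0) [d /= d0 dP] := cf t.
pose k := Num.min 1 (d / (q - p)).
have qp0 : 0 < q - p by rewrite subr_gt0.
have k0 : 0 < k by rewrite lt_min ltr01 divr_gt0.
have k1 : k <= 1 by rewrite ge_min lexx.
have kd : k * (q - p) <= d by rewrite -ler_pdivlMr// ge_min lexx orbT.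
(* Moving [t] a fraction [k] of the way to the midpoint lands in the open interval, where [f]
   vanishes, at a distance below [d]. *)
pose h := (p + q) / 2 - t.
have hE : - (q - p) < h < q - p /\ (p < t + h < q) /\ p <= t <= q.
  by move: tpq; rewrite in_itv/= /h; clear -pq => tpq; lra.
have kh : `|k * h| < d.
  apply: lt_le_trans kd; rewrite normrM (gtr0_norm k0) ltr_pM2l// ltr_norml.
  by case: hE.
have := dP (t + k * h); rewrite /= opprD addrA subrr add0r normrN => /(_ kh).
suff th : t + k * h \in `]p, q[ by rewrite (f0 _ th) subr0 ltxx.
rewrite in_itv/=; case: hE => _ [/andP[h1 h2] /andP[h3 h4]].
have e1 : t + k * h - p = (1 - k) * (t - p) + k * (t + h - p) by ring.
have e2 : q - (t + k * h) = (1 - k) * (q - t) + k * (q - (t + h)) by ring.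
rewrite -subr_gt0 e1 -[_ < q]subr_gt0 e2.
by rewrite !ltr_wpDl// ?mulr_ge0 ?mulr_gt0// ?subr_ge0// subr_gt0.
Qed.

(* Tested against [w = (T - t)^+ (P - c)], where [c] makes its integral over [[a, T]]
   vanish, and against [w = (t - T)^+ P]. *)
Lemma du_Bois_Reymond a T b P : continuous P -> a < T -> T <= b ->
  (forall w, continuous w -> \int[mu]_(t in `[a, T]) w t = 0 ->
    \int[mu]_(t in `[a, b]) (w t * P t) = 0) ->
  exists2 c, {in `[a, T], forall t, P t = c} &
    (T < b -> {in `[T, b], forall t, P t = 0}).
Proof.
move=> cP aT Tb H.
have cM f g : continuous f -> continuous g -> continuous (fun t => f t * g t).
  by move=> cf cg t; apply: cvgM; [exact: cf|exact: cg].
have cB f g : continuous f -> continuous g -> continuous (fun t => f t - g t).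
  by move=> cf cg t; apply: cvgB; [exact: cf|exact: cg].
have cid : continuous (@id R) by move=> t; exact: cvg_id.
have cc (k : R) : continuous (fun _ : R => k) by move=> t; exact: cvg_cst.
have split_int f : continuous f -> \int[mu]_(t in `[a, b]) f t =
    \int[mu]_(t in `[a, T]) f t + \int[mu]_(t in `[T, b]) f t.
  move=> cf; apply: Rintegral_itv_cat => //; last exact: ltW.
  exact: continuous_integrable_itv.
have int0 p q f : {in `[p, q], forall t, f t = 0} -> \int[mu]_(t in `[p, q]) f t = 0.
  by move=> f0; rewrite /Rintegral integral0_eq// => t /= tD; rewrite f0.
pose m1 t := Num.max 0 (T - t); pose m2 t := Num.max 0 (t - T).
have cm1 : continuous m1 by apply: continuous_maxl; exact: cB.
have cm2 : continuous m2 by apply: continuous_maxl; exact: cB.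
have m1E : {in `[T, b], forall t, m1 t = 0}.
  by move=> t; rewrite in_itv/= => /andP[Tt _]; apply/max_idPl; rewrite subr_le0.
have m2E : {in `[a, T], forall t, m2 t = 0}.
  by move=> t; rewrite in_itv/= => /andP[_ tT]; apply/max_idPl; rewrite subr_le0.
have m1_gt0 t : t < T -> 0 < m1 t by rewrite /m1 lt_max subr_gt0 => ->; rewrite orbT.
have m2_gt0 t : T < t -> 0 < m2 t by rewrite /m2 lt_max subr_gt0 => ->; rewrite orbT.
have m1_ge0 t : 0 <= m1 t by rewrite le_max lexx.
have m2_ge0 t : 0 <= m2 t by rewrite le_max lexx.
pose I := \int[mu]_(t in `[a, T]) m1 t.
have I_neq0 : I != 0.
  apply/eqP => I0.
  have mid : (a + T) / 2 \in `]a, T[ by rewrite in_itv/= midf_lt// midf_lt.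
  have := Rintegral_continuous_eq0 cm1 (fun t _ => m1_ge0 t) I0 aT mid.
  by apply/eqP; rewrite gt_eqF// m1_gt0//; move: mid; rewrite in_itv/= => /andP[].
pose c := (\int[mu]_(t in `[a, T]) (m1 t * P t)) / I.
exists c.
  pose w t := m1 t * (P t - c).
  have cw : continuous w by apply: (cM m1 _ cm1); exact: (cB P).
  have w0 : \int[mu]_(t in `[a, T]) w t = 0.
    rewrite /w; under eq_Rintegral => t _ do rewrite mulrBr [m1 t * c]mulrC.
    have i1 := continuous_integrable_itv a T cm1.
    rewrite (RintegralB _ (continuous_integrable_itv a T (cM _ _ cm1 cP)) (integrableZl _ c i1))//.
    by rewrite (RintegralZl c _ i1)// -/I /c divfK// subrr.
  have := H w cw w0; rewrite split_int; last exact: cM.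
  rewrite (int0 T b) ?addr0; last by move=> t tT; rewrite /w m1E// !mul0r.
  move=> wP0.
  (* As [w] has integral 0, subtracting [c] from [P] changes nothing, and the integrand becomes the
     nonnegative [m1 * (P - c) ^ 2]. *)
  have sq0 : \int[mu]_(t in `[a, T]) (w t * (P t - c)) = 0.
    under eq_Rintegral => t _ do rewrite mulrBr [w t * c]mulrC.
    have iw := continuous_integrable_itv a T cw.
    rewrite (RintegralB _ (continuous_integrable_itv a T (cM _ _ cw cP)) (integrableZl _ c iw))//.
    by rewrite (RintegralZl c _ iw)// wP0 w0 mulr0 subrr.
  have csq : continuous (fun t => w t * (P t - c)) by apply: (cM w _ cw); exact: (cB P).
  have sq_ge0 t : t \in `[a, T] -> 0 <= w t * (P t - c).
    by move=> _; rewrite /w -mulrA mulr_ge0// -expr2 sqr_ge0.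
  have E := Rintegral_continuous_eq0 csq sq_ge0 sq0 aT.
  have Pc : {in `[a, T], forall t, P t - c = 0}.
    apply: continuous_itv_cc_eq0 => //; first exact: (cB P).
    move=> t tT; have /eqP := E t tT; rewrite /w -mulrA mulf_eq0 mulf_eq0 orbb.
    rewrite gt_eqF/= => [/eqP//|]; apply: m1_gt0.
    by move: tT; rewrite in_itv/= => /andP[].
  by move=> t /Pc /eqP; rewrite subr_eq0 => /eqP.
move=> Tb'.
pose w t := m2 t * P t.
have cw : continuous w by exact: cM.
have w0 : \int[mu]_(t in `[a, T]) w t = 0.
  by apply: int0 => t tT; rewrite /w m2E// mul0r.
have := H w cw w0; rewrite split_int; last exact: cM.
rewrite (int0 a T) ?add0r; last by move=> t tT; rewrite /w m2E// !mul0r.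
move=> sq0.
have csq : continuous (fun t => w t * P t) by exact: cM.
have sq_ge0 t : t \in `[T, b] -> 0 <= w t * P t.
  by move=> _; rewrite /w -mulrA mulr_ge0// -expr2 sqr_ge0.
have E := Rintegral_continuous_eq0 csq sq_ge0 sq0 Tb'.
apply: continuous_itv_cc_eq0 => // t tT; have /eqP := E t tT.
rewrite /w -mulrA mulf_eq0 mulf_eq0 orbb gt_eqF/= => [/eqP//|].
by apply: m2_gt0; move: tT; rewrite in_itv/= => /andP[].
Qed.

(** Writing integration from [a] as an operator with a weakly singular kernel of exponent 0 submits
    the state to the same continuity and Fubini lemmas as its Caputo derivative. The strict
    inequality gives the value 0 required on the diagonal. *)
Definition step_kernel t s : R := if s < t then 1 else 0.

Lemma weakly_singular_step_kernel a b : weakly_singular a b step_kernel.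
Proof.
split; last 2 first.
- by move=> t; rewrite /step_kernel ltxx.
- have cB : continuous (fun p : R * R => p.1 - p.2).
    by move=> p; apply: cvgB; [exact: cvg_fst|exact: cvg_snd].
  move=> t s ts; apply/cvgrPdist_lt => e e0.
  suff : \forall p \near (t, s), step_kernel p.1 p.2 = step_kernel t s.
    by apply: filterS => p /= ->; rewrite subrr normr0.
  move: ts; rewrite neq_lt => /orP[ts|st].
    have := @cvgr_lt _ _ _ _ _ _ (cB (t, s)) 0.
    rewrite subr_lt0 => /(_ _ ts); apply: filterS => p /=.
    rewrite /step_kernel subr_lt0 => /ltW pp.
    by rewrite !ltNge pp (ltW ts).
  have := @cvgr_gt _ _ _ _ _ _ (cB (t, s)) 0.
  rewrite subr_gt0 => /(_ _ st); apply: filterS => p /=.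
  by rewrite /step_kernel subr_gt0 => ->; rewrite st.
exists 1, 0; split; rewrite ?lexx ?ltr01// => t s _ _.
rewrite oppr0 powRr0 mulr1 /step_kernel.
by case: ltP => _; rewrite ?normr1 ?normr0.
Qed.

Lemma integral_op_step_kernel a b w t : continuous w -> t \in `[a, b] ->
  integral_op step_kernel a b w t = \int[mu]_(s in `[a, t]) w s.
Proof.
move=> cw; rewrite in_itv/= => /andP[at_ tb].
have eq_in : {in `]a, t[, (fun s => step_kernel t s * w s) =1 w}.
  by move=> s; rewrite in_itv/= /step_kernel => /andP[_ ->] /=; rewrite mul1r.
have [_ <-] := integrable_itv_oo_eq eq_in (continuous_integrable_itv a t cw).
apply/esym; apply: Rintegral_itv_widen => // s sab.
move: sab; rewrite /step_kernel !in_itv/= => /andP[-> _] /=.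
by case: ltgtP => _; rewrite ?mul0r.
Qed.

Lemma integral_op_step_kernel_tr a T w s : continuous w -> s \in `[a, T] ->
  integral_op (fun t s => step_kernel s t) a T w s = \int[mu]_(t in `[s, T]) w t.
Proof.
move=> cw; rewrite in_itv/= => /andP[as_ sT].
have eq_in : {in `]s, T[, (fun t => step_kernel t s * w t) =1 w}.
  by move=> t; rewrite in_itv/= /step_kernel => /andP[-> _] /=; rewrite mul1r.
have [_ <-] := integrable_itv_oo_eq eq_in (continuous_integrable_itv s T cw).
apply/esym; apply: Rintegral_itv_widen => // t.
rewrite /step_kernel !in_itv/= => /andP[_ ->]; rewrite andbT.
by case: ltgtP => _; rewrite ?mul0r.
Qed.

Lemma integral_op_lin a b K k1 k2 y1 y2 c d t : weakly_singular a b K ->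
  continuous y1 -> continuous y2 -> a <= c -> d <= b -> t \in `[a, b] ->
  integral_op K c d (fun s => k1 * y1 s + k2 * y2 s) t =
    k1 * integral_op K c d y1 t + k2 * integral_op K c d y2 t.
Proof.
move=> wK c1 c2 ac db tab.
have i1 := weakly_singular_integrable wK c1 tab ac db.
have i2 := weakly_singular_integrable wK c2 tab ac db.
rewrite /integral_op -(RintegralZl k1 _ i1)// -(RintegralZl k2 _ i2)//.
rewrite -(RintegralD _ (integrableZl _ k1 i1) (integrableZl _ k2 i2))//.
by apply: eq_Rintegral => s _; ring.
Qed.

Lemma integral_op_eq0 K c d y t : (forall s, s \in `[c, d] -> K t s = 0) ->
  integral_op K c d y t = 0.
Proof.
move=> K0; rewrite /integral_op /Rintegral integral0_eq// => s /= scd.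
by rewrite K0 ?mul0r.
Qed.

End Auxiliary.

(** * Admissible directions and the multiplier rule at a local minimum *)

Section MultiplierRule.
Context {R : realType}.
Notation mu := (@lebesgue_measure R).
Variables (a b : R) (ab : a < b) (al be : R -> R -> R) (gam : R * R).
Hypotheses (hal : fractional_order a b al) (hbe : fractional_order a b be).
Implicit Types (s t T k : R) (x w W : R -> R) (z : R -> R -> R -> R).

Local Notation M := (Caputo_kernel a b al be gam).
Local Notation C := (combined_Caputo a b gam al be).
Local Notation clp := (clamp a b).
Let wM : weakly_singular a b M := weakly_singular_Caputo_kernel ab gam hal hbe.

(* The admissible directions are the primitives of continuous functions [w] with
   [\int_a^T w = 0], so that they vanish at [a] and at [T]. *)
Definition state_variation w t : R := integral_op step_kernel a b w (clp t).
Definition Caputo_variation w t : R := integral_op M a b w (clp t).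

Lemma continuous_state_variation w : continuous w -> continuous (state_variation w).
Proof.
move=> cw; apply: (within_continuous_clamp (ltW ab)).
exact: (continuous_integral_op (weakly_singular_step_kernel a b)).
Qed.

Lemma continuous_Caputo_variation w : continuous w -> continuous (Caputo_variation w).
Proof.
move=> cw; apply: (within_continuous_clamp (ltW ab)).
exact: (continuous_integral_op wM).
Qed.

Definition is_primitive w W : Prop :=
  forall t, a - 1 < t -> derivable W t 1 /\ derive1 W t = w t.

Lemma combined_Caputo_primitive w W : continuous w -> is_primitive w W ->
  {in `[a, b], forall t, C W t = integral_op M a b w t}.
Proof.
move=> cw dW t tab.
have e0 : combined_Caputo_exists a b al be (cst 0) t.
  split; apply: (eq_integrable _ (cst 0%E)) (integrable0 _ _) => //= s _;
  by rewrite derive1_cst mulr0.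
have Wx : {in `]a, b[, forall s, derive1 W s = derive1 (cst 0) s + w s}.
  move=> s; rewrite in_itv/= => /andP[as_ _]; rewrite derive1_cst add0r.
  by have [] := dW s; first lra.
have [_ ->] := combined_Caputo_perturb ab gam hal hbe cw tab Wx e0.
have z0 (f : R -> R) p q : \int[mu]_(s in `[p, q]) (f s * derive1 (cst 0 : R -> R) s) = 0.
  by rewrite /Rintegral integral0_eq// => s _; rewrite derive1_cst mulr0.
by rewrite /combined_Caputo /left_Caputo /right_Caputo /left_integral /right_integral
  !z0 !mulr0 !add0r.
Qed.

Lemma in_D_perturb x w W T : in_D a b gam al be x T -> continuous w ->
  is_primitive w W ->
  in_D a b gam al be (fun t => x t + W t) T /\
  {in `[a, b], forall t, C (fun t => x t + W t) t = C x t + integral_op M a b w t}.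
Proof.
move=> [[dx [dxE cdx]] Tab ex cC] cw dW.
have Wd s : s \in `[a, b] -> derivable W s 1 /\ derive1 W s = w s.
  by rewrite in_itv/= => /andP[as_ _]; apply: dW; lra.
have xW : {in `]a, b[, forall s,
    derive1 (fun t => x t + W t) s = derive1 x s + w s}.
  move=> s sab; have sab' := subset_itv_oo_cc sab.
  have idx := is_derivative_within_interior sab (dxE s sab').
  have [dWs <-] := Wd s sab'.
  have idW : is_derive s 1 W (derive1 W s) by rewrite derive1E; exact: derivableP.
  have [_ E] : is_derive s 1 (x + W) (dx s + derive1 W s) by exact: is_deriveD.
  by rewrite derive1E E; congr (_ + _); rewrite derive1E; case: idx.
have perturb t tab := combined_Caputo_perturb ab gam hal hbe cw tab xW (ex t tab).
split; last by move=> t tab; have [] := perturb t tab.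
split; [|exact: Tab| |].
- exists (fun t => dx t + w t); split.
    move=> t tab; have [dWt Wt] := Wd t tab.
    have := @is_derivative_within_lincomb _ _ _ _ _ _ _ 1 1 (dxE t tab)
      (derivable_is_derivative_within `[a, b]%classic dWt).
    rewrite Wt !mul1r; apply: is_derivative_within_eq => // s _.
    by rewrite !mul1r.
  move=> t; apply: cvgD; first exact: cdx.
  exact: (continuous_subspaceT cw).
- by move=> t tab; have [] := perturb t tab.
- apply/subspace_continuousP => t tab.
  have cC' : C x s + integral_op M a b w s @[s --> within `[a, b] (nbhs t)] -->
      C x t + integral_op M a b w t.
    apply: cvgD; first by have /subspace_continuousP := cC; apply.
    by have /subspace_continuousP := continuous_integral_op wM cw (lexx a) (lexx b); apply.
  have -> : from_subspace `[a, b] (combined_Caputo a b gam al be (fun t => x t + W t)) t =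
      C x t + integral_op M a b w t by have [] := perturb t tab.
  apply: cvg_trans cC'; apply: near_eq_cvg; rewrite near_withinE; apply: nearW => s sab.
  by have [_] := perturb s sab.
Qed.

Lemma normD_primitive_le w W B : continuous w -> is_primitive w W ->
  {in `[a, b], forall t, `|W t| <= B /\ `|integral_op M a b w t| <= B} ->
  normD a b gam al be W 0 <= 2 * B.
Proof.
move=> cw dW HB; rewrite /normD normr0 addr0 mulr_natl mulr2n.
have aab : a \in `[a, b] by rewrite in_itv/= lexx ltW.
apply: lerD; apply: ge_sup.
- by exists `|W a|; exists a.
- by move=> _ [t tab <-]; have [] := HB t tab.
- by exists `|combined_Caputo a b gam al be W a|; exists a.
- move=> _ [t tab <-]; rewrite (combined_Caputo_primitive cw dW)//.
  by have [] := HB t tab.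
Qed.

Section LocalMinimum.
Variables (L g : R -> R -> R -> R) (hL : C1_strip3 a b L) (hg : C1_strip3 a b g).
Variables (phi : R -> R -> R) (psi : R -> R) (xa : R) (x : R -> R) (T : R).
Hypothesis hmin : local_minimum a b gam al be
  (fun y S => \int[mu]_(t in `[a, S]) along a b gam al be L y t + phi S (y S))
  (fun y S => y a = xa /\
     \int[mu]_(t in `[a, S]) along a b gam al be g y t = psi S) x T.
Hypothesis aT : a < T.

Let xD : in_D a b gam al be x T. Proof. by case: hmin. Qed.

Let Tb : T <= b.
Proof. by have [_ + _ _] := xD; rewrite in_itv/= => /andP[]. Qed.

Let subT t : t \in `[a, T] -> t \in `[a, b].
Proof. by rewrite !in_itv/= => /andP[-> /le_trans->]. Qed.

Let xc := x \o clp.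
Let vc := C x \o clp.

Lemma continuous_clamped_state : continuous xc.
Proof.
apply: (within_continuous_clamp (ltW ab)).
by apply: C1_on_continuous; case: xD.
Qed.

Lemma continuous_clamped_Caputo : continuous vc.
Proof. by apply: (within_continuous_clamp (ltW ab)); case: xD. Qed.

Let zc z t := z (clp t).

Definition functional_variation z w : R :=
  variation a T xc vc (zc z) (state_variation w) (Caputo_variation w).

Lemma functional_variation_lincomb z k1 k2 w1 w2 : C1_strip3 a b z ->
  continuous w1 -> continuous w2 ->
  functional_variation z (fun t => k1 * w1 t + k2 * w2 t) =
    k1 * functional_variation z w1 + k2 * functional_variation z w2.
Proof.
move=> hz c1 c2; have hzc := C1_strip3_clamp (ltW ab) hz.
have := variation_lincomb a T continuous_clamped_state continuous_clamped_Caputo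
  k1 k2 hzc (continuous_state_variation c1) (continuous_state_variation c2)
  (continuous_Caputo_variation c1) (continuous_Caputo_variation c2).
move=> <-; congr variation; apply/funext => t.
- by apply: (integral_op_lin _ _ (weakly_singular_step_kernel a b)) => //; exact: clamp_in (ltW ab).
- by apply: (integral_op_lin _ _ wM) => //; exact: clamp_in (ltW ab).
Qed.

Lemma no_constrained_descent w1 w2 : continuous w1 -> continuous w2 ->
  \int[mu]_(t in `[a, T]) w1 t = 0 -> \int[mu]_(t in `[a, T]) w2 t = 0 ->
  functional_variation g w1 = 0 -> functional_variation g w2 = 1 ->
  ~~ (functional_variation L w1 < 0).
Proof.
move=> c1 c2 w10 w20 g1 g2; apply/negP => L1.
have [_ [xaE gT] [delta delta0 minJ]] := hmin.
have hLc := C1_strip3_clamp (ltW ab) hL; have hgc := C1_strip3_clamp (ltW ab) hg.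
have cs1 := continuous_state_variation c1; have cs2 := continuous_state_variation c2.
have cC1 := continuous_Caputo_variation c1; have cC2 := continuous_Caputo_variation c2.
have [p p0 P1] := continuous_bounded_itv a b cs1.
have [q q0 P2] := continuous_bounded_itv a b cs2.
have [r r0 P3] := continuous_bounded_itv a b cC1.
have [s s0 P4] := continuous_bounded_itv a b cC2.
pose B := 1 + p + q + r + s.
have [B1 Bpq Brs] := sum4_bounds p0 q0 r0 s0; rewrite -/B in B1 Bpq Brs.
have B0 : 0 < B by exact: lt_le_trans B1.
(* With coefficients at most [delta / (4 * B)], the perturbation and its Caputo derivative are each
   at most [delta / 4], so the norm is at most [delta / 2]. *)
have d0 : 0 < delta / (4 * B) by rewrite divr_gt0 ?mulr_gt0.
have [k1 [k2 [k1d k2d Eg EL]]] := constrained_descent (ltW aT)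
  continuous_clamped_state continuous_clamped_Caputo hLc hgc cs1 cC1 cs2 cC2 g1 g2 L1 d0.
pose w t := k1 * w1 t + k2 * w2 t.
have cw : continuous w.
  by move=> t; apply: cvgD; apply: cvgM; [exact: cvg_cst|exact: c1|exact: cvg_cst|exact: c2].
have [W [Wa dW WE]] := primitive_exists a cw.
have sE t : t \in `[a, b] -> k1 * state_variation w1 t + k2 * state_variation w2 t = W t.
  move=> tab; rewrite /state_variation clamp_id//.
  rewrite -(integral_op_lin _ _ (weakly_singular_step_kernel a b))//.
  rewrite integral_op_step_kernel// (WE a t) ?Wa ?add0r//.
  by move: tab; rewrite in_itv/= => /andP[].
have vE t : t \in `[a, b] ->
    k1 * Caputo_variation w1 t + k2 * Caputo_variation w2 t = integral_op M a b w t.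
  by move=> tab; rewrite /Caputo_variation clamp_id// -(integral_op_lin _ _ wM).
have [yD yC] := in_D_perturb xD cw dW.
have alongE z : \int[mu]_(t in `[a, T]) along a b gam al be z (fun t => x t + W t) t =
    action a T xc vc (zc z)
      (fun t => k1 * state_variation w1 t + k2 * state_variation w2 t)
      (fun t => k1 * Caputo_variation w1 t + k2 * Caputo_variation w2 t).
  apply: eq_Rintegral => t; rewrite inE/= => /subT tab.
  rewrite sE// vE// /zc /along /xc /vc /= clamp_id//.
  by congr (z _ _ _); exact: yC.
have alongxE z : \int[mu]_(t in `[a, T]) along a b gam al be z x t =
    action a T xc vc (zc z) (cst 0) (cst 0).
  apply: eq_Rintegral => t; rewrite inE/= => /subT tab.
  by rewrite /zc /along /xc /vc /= clamp_id// !addr0.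
have WT : W T = 0.
  rewrite (WE a T) ?(ltW aT)// Wa add0r /w.
  have i1 := continuous_integrable_itv a T c1.
  have i2 := continuous_integrable_itv a T c2.
  rewrite (RintegralD _ (integrableZl _ k1 i1) (integrableZl _ k2 i2))//.
  by rewrite (RintegralZl k1 _ i1)// (RintegralZl k2 _ i2)// w10 w20 !mulr0 addr0.
have small : normD a b gam al be (fun t => x t + W t - x t) (T - T) < delta.
  rewrite subrr (_ : (fun t => _) = W); last by apply/funext => t; ring.
  apply: (@le_lt_trans _ _ (2 * (delta / (4 * B) * B))).
    apply: (normD_primitive_le cw dW) => t tab; rewrite -sE// -vE//.
    have bound (e f u v : R) : `|e| <= u -> `|f| <= v -> u + v <= B ->
        `|k1 * e + k2 * f| <= delta / (4 * B) * B.
      move=> eu fv uvB; apply: le_trans (ler_normD _ _) _; rewrite !normrM.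
      apply: (@le_trans _ _ (delta / (4 * B) * (u + v))).
        by rewrite mulrDr lerD// ler_pM.
      by rewrite ler_wpM2l// ltW.
    split.
      by apply: (bound _ _ p q) Bpq; [exact: P1|exact: P2].
    by apply: (bound _ _ r s) Brs; [exact: P3|exact: P4].
  rewrite (_ : 2 * _ = delta / 2); last by field; rewrite gt_eqF.
  by rewrite ltr_pdivrMr// ltr_pMr// ltr1n.
have yc : x a + W a = xa /\
    \int[mu]_(t in `[a, T]) along a b gam al be g (fun t => x t + W t) t = psi T.
  by rewrite Wa addr0 alongE Eg -alongxE.
have xWT : x T + W T = x T by rewrite WT addr0.
have cancel (A A' D D' h h' : R) : A = A' -> D = D' -> h = h' ->
    A + h <= D + h' -> A' <= D'.
  by move=> -> -> ->; rewrite lerD2r.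
have := cancel _ _ _ _ _ _ (alongxE L) (alongE L) (congr1 (phi T) (esym xWT))
  (minJ _ _ yD yc small).
by move=> /le_lt_trans/(_ EL); rewrite ltxx.
Qed.

Lemma multiplier_rule : exists lam0 lam : R, (lam0, lam) <> (0, 0) /\
  forall w, continuous w -> \int[mu]_(t in `[a, T]) w t = 0 ->
    lam0 * functional_variation L w - lam * functional_variation g w = 0.
Proof.
have [g0|/existsNP[w2 /not_implyP[c2 /not_implyP[w20 /eqP g2]]]] :=
  pselect (forall w, continuous w -> \int[mu]_(t in `[a, T]) w t = 0 ->
    functional_variation g w = 0).
  exists 0, 1; split; first by case=> /eqP; rewrite oner_eq0.
  by move=> w cw w0; rewrite mul0r mul1r g0// subr0.
have lc k1 k2 (f h : R -> R) : continuous f -> continuous h ->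
    \int[mu]_(t in `[a, T]) f t = 0 -> \int[mu]_(t in `[a, T]) h t = 0 ->
    continuous (fun t => k1 * f t + k2 * h t) /\
    \int[mu]_(t in `[a, T]) (k1 * f t + k2 * h t) = 0.
  move=> cf ch f0 h0; split.
    by move=> t; apply: cvgD; apply: cvgM; [exact: cvg_cst|exact: cf|exact: cvg_cst|exact: ch].
  have i1 := continuous_integrable_itv a T cf.
  have i2 := continuous_integrable_itv a T ch.
  rewrite (RintegralD _ (integrableZl _ k1 i1) (integrableZl _ k2 i2))//.
  by rewrite (RintegralZl k1 _ i1)// (RintegralZl k2 _ i2)// f0 h0 !mulr0 addr0.
set G := functional_variation g w2 in g2.
(* This [lam] is forced by the direction [w2], on which the combined variation must vanish. *)
exists 1, (functional_variation L w2 / G); split; first by case=> /eqP; rewrite oner_eq0.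
(* Subtracting the right multiple of [w2] from [k * w] annihilates the variation of the constraint,
   and [w2] divided by [G] is the normalized corrector. No descent is then possible; taking [k = 1]
   and [k = -1] gives equality. *)
have le0 k w : continuous w -> \int[mu]_(t in `[a, T]) w t = 0 ->
    0 <= k * (1 * functional_variation L w -
      functional_variation L w2 / G * functional_variation g w).
  move=> cw w0.
  have [c1 w10] := lc k (- (k * functional_variation g w / G)) w w2 cw c2 w0 w20.
  have [c3 w30] := lc G^-1 0 w2 w2 c2 c2 w20 w20.
  have := no_constrained_descent c1 c3 w10 w30.
  have -> := functional_variation_lincomb k (- (k * functional_variation g w / G)) hg cw c2.
  have -> := functional_variation_lincomb k (- (k * functional_variation g w / G)) hL cw c2.
  have -> := functional_variation_lincomb G^-1 0 hg c2 c2.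
  rewrite -/G; move: (functional_variation L w) (functional_variation L w2).
  move: (functional_variation g w) => gw Lw Lw2.
  rewrite mulNr divfK// subrr mul0r addr0 mulVf// => /(_ erefl erefl); rewrite -leNgt.
  by rewrite (_ : k * (1 * Lw - _) = k * Lw + - (k * gw / G) * Lw2)//; ring.
move=> w cw w0; apply/eqP; rewrite eq_le.
have := le0 1 w cw w0; have := le0 (-1) w cw w0.
by rewrite mulN1r oppr_ge0 !mul1r => -> ->.
Qed.

End LocalMinimum.
End MultiplierRule.

(** * From the integrated equation to the Euler-Lagrange equations *)

Section EulerLagrange.
Context {R : realType}.
Notation mu := (@lebesgue_measure R).
Variables (a b : R) (ab : a < b) (al be : R -> R -> R) (gam : R * R).
Hypotheses (hal : fractional_order a b al) (hbe : fractional_order a b be).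
Variables (T : R) (aT : a < T) (Tb : T <= b).
Implicit Types (c d s t : R) (w f y : R -> R) (K : R -> R -> R).

Local Notation M := (Caputo_kernel a b al be gam).
Let wM : weakly_singular a b M := weakly_singular_Caputo_kernel ab gam hal hbe.

Let subT t : t \in `[a, T] -> t \in `[a, b].
Proof. by rewrite !in_itv/= => /andP[-> /le_trans->]. Qed.

Let subTb t : t \in `[T, b] -> t \in `[a, b].
Proof. by rewrite !in_itv/= => /andP[/(le_trans (ltW aT))-> ->]. Qed.

Lemma Fubini_clamped K f w : weakly_singular a b K -> continuous f -> continuous w ->
  \int[mu]_(t in `[a, T]) (f t * integral_op K a b w (clamp a b t)) =
  \int[mu]_(s in `[a, b]) (w s * integral_op (fun t s => K s t) a T f (clamp a b s)).
Proof.
move=> wK cf cw.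
transitivity (\int[mu]_(t in `[a, T]) (f t * integral_op K a b w t)).
  by apply: eq_Rintegral => t; rewrite inE/= => /subT tab; rewrite clamp_id.
apply: etrans (Fubini_integral_op wK cf cw (lexx a) Tb (lexx a) (lexx b)) _.
by apply: eq_Rintegral => t; rewrite inE/= => tab; rewrite clamp_id.
Qed.

Lemma Rintegral_continuousD c d f y : continuous f -> continuous y ->
  \int[mu]_(t in `[c, d]) (f t + y t) =
  \int[mu]_(t in `[c, d]) f t + \int[mu]_(t in `[c, d]) y t.
Proof.
by move=> cf cy; rewrite RintegralD//; exact: continuous_integrable_itv.
Qed.

Lemma integrated_Euler_Lagrange f2 f3 : continuous f2 -> continuous f3 ->
  (forall w, continuous w -> \int[mu]_(t in `[a, T]) w t = 0 ->
    \int[mu]_(t in `[a, T]) (f2 t * state_variation a b w t +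
      f3 t * Caputo_variation a b al be gam w t) = 0) ->
  exists2 c, {in `[a, T], forall s, \int[mu]_(t in `[s, T]) f2 t +
      integral_op (fun s t => M t s) a T f3 s = c} &
    (T < b -> {in `[T, b], forall s, integral_op (fun s t => M t s) a T f3 s = 0}).
Proof.
move=> c2 c3 H.
have wS := weakly_singular_step_kernel a b.
pose P2 t := integral_op (fun s t => step_kernel t s) a T f2 (clamp a b t).
pose P3 t := integral_op (fun s t => M t s) a T f3 (clamp a b t).
have cP2 : continuous P2.
  apply: (within_continuous_clamp (ltW ab)).
  exact: (continuous_integral_op (weakly_singular_tr wS)).
have cP3 : continuous P3.
  apply: (within_continuous_clamp (ltW ab)).
  exact: (continuous_integral_op (weakly_singular_tr wM)).
have cM (f h : R -> R) : continuous f -> continuous h -> continuous (fun t => f t * h t).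
  by move=> cf ch t; apply: cvgM; [exact: cf|exact: ch].
pose P t := P2 t + P3 t.
have cP : continuous P by move=> t; apply: cvgD; [exact: cP2|exact: cP3].
have [w cw w0|c cT cb] := du_Bois_Reymond cP aT Tb.
  have cs := continuous_state_variation ab cw.
  have cC := continuous_Caputo_variation (gam := gam) ab hal hbe cw.
  have E1 : \int[mu]_(t in `[a, b]) (w t * P t) = \int[mu]_(t in `[a, b]) (w t * P2 t) +
      \int[mu]_(t in `[a, b]) (w t * P3 t).
    apply: etrans (Rintegral_continuousD _ _ (cM _ _ cw cP2) (cM _ _ cw cP3)).
    by apply: eq_Rintegral => t _; rewrite -mulrDr.
  apply: etrans E1 _; apply: etrans (H w cw w0); apply/esym.
  apply: etrans (Rintegral_continuousD _ _ (cM _ _ c2 cs) (cM _ _ c3 cC)) _.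
  exact: (congr2 +%R (Fubini_clamped wS c2 cw) (Fubini_clamped wM c3 cw)).
exists c.
  move=> s sT; rewrite -[RHS](cT s sT) /P /P2 /P3 (clamp_id (subT sT)).
  by rewrite (integral_op_step_kernel_tr c2 sT).
move=> Tb' s sTb; have := cb Tb' s sTb; rewrite /P /P2 /P3 (clamp_id (subTb sTb)).
(* At times up to [T] the state does not see [w] beyond [T], so [f2] leaves no trace on [[T, b]]. *)
suff -> : integral_op (fun s t => step_kernel t s) a T f2 s = 0 by rewrite add0r.
apply: integral_op_eq0 => t; rewrite /step_kernel.
move: sTb; rewrite !in_itv/= => /andP[Ts _] /andP[_ tT].
by rewrite ltNge (le_trans tT Ts).
Qed.

Section Equations.
Variables (F2 F3 f2 f3 : R -> R).
Hypotheses (c2 : continuous f2) (c3 : continuous f3).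
Hypotheses (F2E : {in `[a, b], F2 =1 f2}) (F3E : {in `[a, b], F3 =1 f3}).

Lemma dual_derivative_Euler_Lagrange c :
  {in `[a, T], forall s, \int[mu]_(t in `[s, T]) f2 t +
    integral_op (fun s t => M t s) a T f3 s = c} ->
  forall t, t \in `[a, T] ->
    exists2 l, is_dual_derivative gam be al a T F3 t l & F2 t + l = 0.
Proof.
move=> Hc t tT; exists (- f2 t); last by rewrite F2E ?subrr// subT.
have [V [_ dV VE]] := primitive_exists a c2.
have [dVt Vt] : derivable V t 1 /\ derive1 V t = f2 t.
  by apply: dV; move: tT; rewrite in_itv/= => /andP[]; lra.
have dc := @derivable_is_derivative_within R `[a, T]%classic _ t (derivable_cst (V T - c) t 1).
(* By [Hc] the combination of fractional integrals is [V T - V s - c] on [[a, T]], a smooth function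
   even if its two terms are not; its derivative is [- f2]. *)
have := @is_derivative_within_lincomb _ _ _ _ _ _ _ (-1) 1
  (derivable_is_derivative_within `[a, T]%classic dVt) dc.
rewrite Vt derive1_cst mulr0 addr0 mulN1r.
apply: is_derivative_within_eq => // s sT /=.
have eF3 q : q <= b -> forall u, u \in `[a, q] -> F3 u = f3 u.
  by move=> qb u; rewrite in_itv/= => /andP[au uq]; apply: F3E; rewrite in_itv/= au (le_trans uq).
rewrite (left_integralE hbe (lexx a) Tb sT (eF3 T Tb)).
rewrite (right_integralE ab hal (lexx a) Tb (subT sT) c3 (eF3 T Tb)).
have := Hc s sT; rewrite (integral_op_Caputo_kernel_tr ab gam hal hbe c3 (lexx a) Tb (subT sT)).
move: (integral_op (frac_kernel a b be) a T f3 s).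
move: (integral_op (fun t s => frac_kernel a b al s t) a T f3 s) => A B.
have [as_ sT'] : a <= s /\ s <= T by apply/andP; move: sT; rewrite /= in_itv.
rewrite (VE s T as_ sT'); move: (\int[mu]_(_ in _) _) => I E.
move: E => <-; ring.
Qed.

(** For [s >= T] the right integral over [[a, T]] is empty up to the diagonal, so the transposed
    kernel retains only the [be] term. That term is the left integral over [[a, T]], which is the
    difference of the left integrals with base points [a] and [T]. *)
Lemma left_RL_difference_Euler_Lagrange :
  (T < b -> {in `[T, b], forall s, integral_op (fun s t => M t s) a T f3 s = 0}) ->
  forall t, t \in `[T, b] -> is_left_RL_difference gam be a T b F3 t 0.
Proof.
move=> H0 t tT; have [Tb'|bT] := ltP T b; last first.
  have -> : b = T by apply/eqP; rewrite eq_le bT.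
  exact: is_derivative_within_point.
have := @derivable_is_derivative_within R `[T, b]%classic _ t (derivable_cst (0 : R) t 1).
rewrite derive1_cst; apply: is_derivative_within_eq => // s sT /=.
have sab := subTb sT.
rewrite (left_integralE hbe (lexx a) (lexx b) sab F3E).
have F3E' u : u \in `[T, b] -> F3 u = f3 u by move=> /subTb; exact: F3E.
rewrite (left_integralE hbe (ltW aT) (lexx b) sab F3E').
have wB := weakly_singular_frac_kernel ab hbe.
have iB := weakly_singular_integrable wB c3 sab (lexx a) (lexx b).
have split_int : integral_op (frac_kernel a b be) a b f3 s =
    integral_op (frac_kernel a b be) a T f3 s + integral_op (frac_kernel a b be) T b f3 s.
  exact: (Rintegral_itv_cat iB (ltW aT) Tb).
rewrite split_int addrK.
have := H0 Tb' s sT; rewrite (integral_op_Caputo_kernel_tr ab gam hal hbe c3 (lexx a) Tb sab).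
have -> : integral_op (fun t s => frac_kernel a b al s t) a T f3 s = 0; last first.
  by rewrite mulr0 sub0r => /eqP; rewrite oppr_eq0 => /eqP ->.
apply: integral_op_eq0 => u uT; rewrite /frac_kernel ltNge.
move: uT sT; rewrite !in_itv/= => /andP[_ uT] /andP[Ts _].
by rewrite (le_trans uT Ts).
Qed.

End Equations.

(** Uniqueness of relative derivatives on [[a, T]], to which the left derivative, taken relative to
    [[a, b]], is first restricted. *)
Lemma dual_derivative_termwise y t l l1 l2 : t \in `[a, T] ->
  is_dual_derivative gam be al a T y t l -> is_left_RL be a b y t l1 ->
  is_right_RL al a T y t l2 -> l = gam.2 * l1 + gam.1 * l2.
Proof.
move=> tT dl d1 d2; apply: (is_derivative_within_itv_unique aT tT dl).
apply: is_derivative_within_lincomb => //.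
by apply: is_derivative_within_sub d1 => s; exact: subT.
Qed.

End EulerLagrange.

Lemma left_RL_difference_termwise (R : realType) (a T b : R) (gam : R * R)
    (be : R -> R -> R) (y : R -> R) (t l l1 l2 : R) : a <= T -> T < b ->
  t \in `[T, b] ->
  is_left_RL_difference gam be a T b y t l -> is_left_RL be a b y t l1 ->
  is_left_RL be T b y t l2 -> gam.2 * (l1 - l2) = l.
Proof.
move=> aT Tb tT dl d1 d2; apply: (is_derivative_within_itv_unique Tb tT _ dl).
have d1' : is_left_RL be a b y t l1 -> is_derivative_within `[T, b] (left_integral be a y) t l1.
  apply: is_derivative_within_sub => s /=.
  by rewrite !in_itv/= => /andP[/(le_trans aT)-> ->].
have := @is_derivative_within_lincomb _ _ _ _ _ _ _ gam.2 (- gam.2) (d1' d1) d2.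
rewrite mulNr -mulrBr; apply: is_derivative_within_eq => // s _.
by rewrite mulNr -mulrBr.
Qed.

(** * Partial derivatives of the combined integrand *)

Section PartialDerivatives.
Context {R : realType}.
Variables (a b : R) (L g : R -> R -> R -> R) (lam0 lam : R).
Hypotheses (hL : C1_strip3 a b L) (hg : C1_strip3 a b g).
Let F (t y v : R) := lam0 * L t y v - lam * g t y v.

Let derive1_lincomb (f h : R -> R) t : derivable f t 1 -> derivable h t 1 ->
  derive1 (fun s => lam0 * f s - lam * h s) t = lam0 * derive1 f t - lam * derive1 h t.
Proof.
move=> /derivableP df /derivableP dh; rewrite !derive1E.
by have [_ ->] := is_deriveB (is_deriveZ lam0 df) (is_deriveZ lam dh).
Qed.

Lemma partial2_lincomb t y v : t \in `[a, b] ->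
  partial2 F t y v = lam0 * partial2 L t y v - lam * partial2 g t y v.
Proof.
move: hL hg => [L1 [dL _]] [g1 [dg _]] tab.
have [_ dLt _] := dL t y v tab; have [_ dgt _] := dg t y v tab.
exact: (derive1_lincomb dLt dgt).
Qed.

Lemma partial3_lincomb t y v : t \in `[a, b] ->
  partial3 F t y v = lam0 * partial3 L t y v - lam * partial3 g t y v.
Proof.
move: hL hg => [L1 [dL _]] [g1 [dg _]] tab.
have [_ _ dLt] := dL t y v tab; have [_ _ dgt] := dg t y v tab.
exact: (derive1_lincomb dLt dgt).
Qed.

End PartialDerivatives.

Unset Implicit Arguments.
Set Strict Implicit.

Theorem theorem3p4 (R : realType) (a b : R) (hab : a < b)
    (al be : R -> R -> R)
    (hal : fractional_order a b al) (hbe : fractional_order a b be)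
    (gam : R * R) (hgam1 : 0 <= gam.1 <= 1) (hgam2 : 0 <= gam.2 <= 1)
    (L g : R -> R -> R -> R) (hL : C1_strip3 a b L) (hg : C1_strip3 a b g)
    (phi : R -> R -> R) (hphi : C1_strip2 a b phi)
    (psi : R -> R) (hpsi : differentiable_on a b psi)
    (xa : R) (x : R -> R) (T : R)
    (hmin : local_minimum a b gam al be
      (fun y S =>
         \int[lebesgue_measure]_(t in `[a, S]) along a b gam al be L y t
         + phi S (y S))
      (fun y S =>
         y a = xa /\
         \int[lebesgue_measure]_(t in `[a, S]) along a b gam al be g y t
         = psi S)
      x T) :
  exists lam0 lam : R, (lam0, lam) <> (0, 0) /\
    let F := fun t y v => lam0 * L t y v - lam * g t y v in
    let F2 := along a b gam al be (partial2 F) x in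
    let F3 := along a b gam al be (partial3 F) x in
    [/\ (* Euler-Lagrange equation on [a, T], including existence of the dual
           derivative *)
        forall t, t \in `[a, T] ->
          exists2 l, is_dual_derivative gam be al a T F3 t l & F2 t + l = 0,
        (* the same, written with the values of the two Riemann-Liouville
           derivatives, wherever these exist *)
        a < T -> forall t l1 l2, t \in `[a, T] ->
          is_left_RL be a b F3 t l1 -> is_right_RL al a T F3 t l2 ->
          F2 t + (gam.2 * l1 + gam.1 * l2) = 0,
        (* equation on [T, b], including existence of the derivative *)
        forall t, t \in `[T, b] ->
          is_left_RL_difference gam be a T b F3 t 0 &
        (* the same, termwise *)
        T < b -> forall t l1 l2, t \in `[T, b] ->
          is_left_RL be a b F3 t l1 -> is_left_RL be T b F3 t l2 ->
          gam.2 * (l1 - l2) = 0].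
Proof.
have [xD _ _] := hmin.
have [x1 Tab ex cCx] := xD.
have [aT_ Tb] : a <= T /\ T <= b by apply/andP; move: Tab; rewrite in_itv.
move: aT_; rewrite le_eqVlt => /predU1P[aT|aT].
  (* When [T = a], any nonzero pair would do: the first equation is at a single point, where
     [- F2 t] is a derivative, and the two base points on [[T, b]] are equal. *)
  exists 1, 0; split; first by case=> /eqP; rewrite oner_eq0.
  move=> F F2 F3.
  have diff0 t : is_left_RL_difference gam be a T b F3 t 0.
    have := @derivable_is_derivative_within R `[T, b]%classic _ t (derivable_cst (0 : R) t 1).
    rewrite derive1_cst /is_left_RL_difference -aT.
    by rewrite (_ : (fun s => _) = cst 0)//; apply/funext => s; rewrite subrr mulr0.
  split; [|by rewrite -aT ltxx|by []|].
  - move=> t _; exists (- F2 t); last by rewrite subrr.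
    by rewrite -aT; exact: is_derivative_within_point.
  - move=> Tb' t l1 l2 tT; apply: left_RL_difference_termwise tT (diff0 t) => //.
    by rewrite -aT.
have [lam0 [lam [lam_neq0 H]]] := multiplier_rule hab hal hbe hL hg hmin aT.
exists lam0, lam; split=> // F F2 F3.
pose xc := x \o clamp a b; pose vc := combined_Caputo a b gam al be x \o clamp a b.
have cxc : continuous xc := continuous_clamped_state hab hmin.
have cvc : continuous vc := continuous_clamped_Caputo hab hmin.
have cid : continuous (@id R) by move=> t; exact: cvg_id.
have [_ _ cL2 cL3] := C1_strip3_clamp (ltW hab) hL.
have [_ _ cg2 cg3] := C1_strip3_clamp (ltW hab) hg.
pose L2 t := partial2 (fun t => L (clamp a b t)) t (xc t) (vc t).
pose L3 t := partial3 (fun t => L (clamp a b t)) t (xc t) (vc t).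
pose g2 t := partial2 (fun t => g (clamp a b t)) t (xc t) (vc t).
pose g3 t := partial3 (fun t => g (clamp a b t)) t (xc t) (vc t).
have kL2 : continuous L2 := continuous_comp3 cL2 cid cxc cvc.
have kL3 : continuous L3 := continuous_comp3 cL3 cid cxc cvc.
have kg2 : continuous g2 := continuous_comp3 cg2 cid cxc cvc.
have kg3 : continuous g3 := continuous_comp3 cg3 cid cxc cvc.
pose f2 t := lam0 * L2 t - lam * g2 t.
pose f3 t := lam0 * L3 t - lam * g3 t.
have kB k k' (f h : R -> R) : continuous f -> continuous h ->
    continuous (fun t => k * f t - k' * h t).
  by move=> cf ch t; apply: cvgB; apply: cvgM; [exact: cvg_cst|exact: cf|exact: cvg_cst|exact: ch].
have c2 : continuous f2 by exact: kB.
have c3 : continuous f3 by exact: kB.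
have F2E : {in `[a, b], F2 =1 f2}.
  move=> t tab; apply: etrans (partial2_lincomb lam0 lam hL hg _ _ tab) _.
  by rewrite /f2 /L2 /g2 /xc /vc /= /partial2 clamp_id.
have F3E : {in `[a, b], F3 =1 f3}.
  move=> t tab; apply: etrans (partial3_lincomb lam0 lam hL hg _ _ tab) _.
  by rewrite /f3 /L3 /g3 /xc /vc /= /partial3 clamp_id.
have [w cw w0|c cT cb] := integrated_Euler_Lagrange (gam := gam) hab hal hbe aT Tb c2 c3.
  rewrite -[RHS](H w cw w0) /functional_variation /variation.
  have cs := continuous_state_variation hab cw.
  have cC := continuous_Caputo_variation (gam := gam) hab hal hbe cw.
  have iL := continuous_integrable_itv a T (continuous_variation_integrand cxc cvc
    (C1_strip3_clamp (ltW hab) hL) cs cC).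
  have ig := continuous_integrable_itv a T (continuous_variation_integrand cxc cvc
    (C1_strip3_clamp (ltW hab) hg) cs cC).
  rewrite -(RintegralZl lam0 _ iL)// -(RintegralZl lam _ ig)//.
  rewrite -(RintegralB _ (integrableZl _ lam0 iL) (integrableZl _ lam ig))//.
  by apply: eq_Rintegral => t _; rewrite /f2 /f3 /L2 /L3 /g2 /g3 /xc /vc /=; ring.
have EL := dual_derivative_Euler_Lagrange hab hal hbe Tb c2 c3 F2E F3E cT.
have diff0 := left_RL_difference_Euler_Lagrange hab hal hbe aT Tb c3 F3E cb.
split.
- exact: EL.
- move=> _ t l1 l2 tT d1 d2; have [l dl <-] := EL t tT.
  by rewrite (dual_derivative_termwise aT Tb tT dl d1 d2).
- exact: diff0.
- move=> Tb' t l1 l2 tT.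
  exact: left_RL_difference_termwise (ltW aT) Tb' tT (diff0 t tT).
Qed.
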